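(* Fix $t\in\mathbb N$ and let $\mathfrak{gl}^M$ be the Mackey Lie algebra of a diagonalizable pairing $V\otimes V_*\to\mathbb C$ with $\dim V=\aleph_t$. The adjoint $\mathfrak{gl}^M$-module is indecomposable, has length $t+4$, and its socle filtration and the layers thereof are given by $$\mathrm{soc}^1\mathfrak{gl}^M=\mathbb C\,\mathrm{id}_V\oplus\mathfrak{sl}(V,V_* ),$$ $$\mathrm{soc}^2\mathfrak{gl}^M=\mathbb C\,\mathrm{id}_V\oplus\mathfrak{gl}(V,V_* ),\qquad \underline{\mathrm{soc}}^2\mathfrak{gl}^M\cong\mathbb C\ \text{(the trivial one-dimensional module)},$$ $$\mathrm{soc}^{s+3}\mathfrak{gl}^M=\mathbb C\,\mathrm{id}_V\oplus\mathfrak{gl}^M_{s+1},\qquad \underline{\mathrm{soc}}^{s+3}\mathfrak{gl}^M=\mathfrak{gl}^M_{s+1}/\mathfrak{gl}^M_s,\qquad s=0,\dots,t-1,$$ $$\mathrm{soc}^{t+3}\mathfrak{gl}^M=\mathfrak{gl}^M,\qquad \underline{\mathrm{soc}}^{t+3}\mathfrak{gl}^M=\mathfrak{gl}^M/(\mathbb C\,\mathrm{id}_V\oplus\mathfrak{gl}^M_t).$$ Moreover, for $s\ge 1$ (with $s+1\le t+3$) the layer $\underline{\mathrm{soc}}^{s+1}\mathfrak{gl}^M$ is a simple $\mathfrak{gl}^M$-module.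
   Context: The ground field is $\mathbb C$, $\otimes=\otimes_{\mathbb C}$, $\mathbb N$ contains $0$. $V$ is a vector space with basis $\{v_b:b\in\mathcal B\}$, $|\mathcal B|=\aleph_t$; $V^*=\mathrm{Hom}(V,\mathbb C)$; $x_b\in V^*$ is defined by $x_b(v_a)=\delta_{ab}$; $V_*:=\mathrm{span}\{x_b:b\in\mathcal B\}\subset V^*$; $\mathbf p:V\otimes V_*\to\mathbb C$ is the evaluation pairing. The Mackey Lie algebra is $\mathfrak{gl}^M:=\{\varphi\in\mathrm{End}(V):\varphi^*(V_* )\subset V_*\}$ with the commutator bracket, where $\varphi^*$ is the dual endomorphism of $V^*$. $\mathfrak{gl}(V,V_* ):=V\otimes V_*\subset\mathfrak{gl}^M$ is the ideal of finite rank elements and $\mathfrak{sl}(V,V_* ):=\ker\mathbf p$. Identify $V^*$ with $\mathrm{Maps}(\mathcal B,\mathbb C)$ via $x\mapsto(b\mapsto x(v_b))$; for $0\le s\le t+1$ let $V^*_s\subset V^*$ be the subspace of those $x$ whose support $\{b: x(v_b)\ne0\}$ has cardinality $<\aleph_s$ (so $V^*_0=V_*$, $V^*_{t+1}=V^*$). Set $\mathfrak{gl}^M_s:=\{\varphi\in\mathfrak{gl}^M:\varphi^*(V^* )\subset V^*_s\}$, an ideal; $\mathfrak{gl}^M_0=\mathfrak{gl}(V,V_* )$ and $\mathfrak{gl}^M_{t+1}=\mathfrak{gl}^M$. For a module $M$: $\mathrm{soc}^1M=\mathrm{soc}M$ is the largest semisimple submodule; $\mathrm{soc}^qM$ is the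 preimage in $M$ of $\mathrm{soc}(M/\mathrm{soc}^{q-1}M)$; the layers are $\underline{\mathrm{soc}}^qM:=\mathrm{soc}^qM/\mathrm{soc}^{q-1}M$. *)

(* Defs.v *)
From HB Require Import structures.
From mathcomp Require Import all_boot all_algebra generic_quotient ring_quotient.
From mathcomp Require Import boolp classical_sets functions cardinality reals.
From mathcomp Require Import complex.

Set Implicit Arguments.
Unset Strict Implicit.
Unset Printing Implicit Defensive.

Import GRing.Theory.
Local Open Scope classical_set_scope.
Local Open Scope card_scope.
Local Open Scope quotient_scope.
Local Open Scope ring_scope.

Definition card_lt (T U : Type) (A : set T) (B : set U) : Prop :=
  (A #<= B) && ~~ (B #<= A).

(* aleph_(n+1) is the successor cardinal of aleph_n; every cardinal at most |A|
   is the cardinal of a subset of A, so the definition only mentions subsets. *)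
Fixpoint has_aleph (n : nat) (T : Type) (A : set T) : Prop :=
  match n with
  | 0 => A #= [set: nat]
  | m.+1 => exists D : set T,
      [/\ D `<=` A, has_aleph m D, card_lt D A &
          forall E : set T, E `<=` A -> card_lt E A -> E #<= D]
  end.

Definition card_lt_aleph (T : Type) (A : set T) (s : nat) : Prop :=
  exists (U : Type) (D : set U), has_aleph s D /\ card_lt A D.

HB.mixin Record Lmodule_isLieAlgebra (K : fieldType) L
    of GRing.Lmodule K L := {
  lieb : L -> L -> L;
  lieb_linearl : forall y, linear (lieb^~ y);
  lieb_linearr : forall x, linear (lieb x);
  liebxx : forall x, lieb x x = 0;
  lieb_jacobi : forall x y z,
    lieb x (lieb y z) + lieb y (lieb z x) + lieb z (lieb x y) = 0
}.

#[short(type="lieAlgType")]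
HB.structure Definition LieAlgebra (K : fieldType) :=
  {L of GRing.Lmodule K L & Lmodule_isLieAlgebra K L}.

HB.mixin Record Lmodule_isLieModule (K : fieldType) (g : lieAlgType K) M
    of GRing.Lmodule K M := {
  lact : g -> M -> M;
  lact_linearl : forall m, linear (lact^~ m);
  lact_linearr : forall x, linear (lact x);
  lact_lieb : forall x y m,
    lact (lieb x y) m = lact x (lact y m) - lact y (lact x m)
}.

#[short(type="lieModType")]
HB.structure Definition LieModule (K : fieldType) (g : lieAlgType K) :=
  {M of GRing.Lmodule K M & Lmodule_isLieModule K g M}.

Definition adjoint (K : fieldType) (g : lieAlgType K) : Type := g.

Lemma linear_at0 (K : fieldType) (U W : lmodType K) (f : U -> W) :
  linear f -> f 0 = 0.
Proof. by move/(_ (-1) 0 0); rewrite scaler0 addr0 !scaleN1r addNr. Qed.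

Lemma linear_atN (K : fieldType) (U W : lmodType K) (f : U -> W) x :
  linear f -> f (- x) = - f x.
Proof.
by move=> Lf; have := Lf (-1) x 0; rewrite (linear_at0 Lf) !addr0 !scaleN1r.
Qed.

Section Adjoint.
Variables (K : fieldType) (g : lieAlgType K).

Lemma liebC (x y : g) : lieb x y = - lieb y x.
Proof.
have Dl (a b c : g) : lieb (a + b) c = lieb a c + lieb b c.
  by have := lieb_linearl c 1 a b; rewrite !scale1r.
have Dr (a b c : g) : lieb c (a + b) = lieb c a + lieb c b.
  by have := lieb_linearr c 1 a b; rewrite !scale1r.
have := liebxx (x + y).
rewrite Dl !Dr !liebxx add0r addr0 => /eqP.
by rewrite addr_eq0 => /eqP.
Qed.

Lemma adjoint_lieb (x y m : g) :
  lieb (lieb x y) m = lieb x (lieb y m) - lieb y (lieb x m).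
Proof.
have /eqP := lieb_jacobi x y m.
rewrite (liebC m x) linear_atN; last exact: lieb_linearr.
rewrite (liebC m) -addrA -opprD.
by rewrite subr_eq0 [lieb y _ + _]addrC => /eqP ->; rewrite addrK.
Qed.

HB.instance Definition _ := GRing.Lmodule.on (adjoint g).
HB.instance Definition _ :=
  @Lmodule_isLieModule.Build K g (adjoint g) (@lieb K g)
    (@lieb_linearl K g) (@lieb_linearr K g) adjoint_lieb.

End Adjoint.

Definition trivial_module (K : fieldType) (g : lieAlgType K) : Type := K^o.

Section TrivialModule.
Variables (K : fieldType) (g : lieAlgType K).

HB.instance Definition _ := GRing.Lmodule.on (trivial_module g).

Definition triv_act (x : g) (m : trivial_module g) : trivial_module g := 0.

Lemma triv_linearl m : linear (triv_act^~ m).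
Proof. by move=> a x y; rewrite /triv_act scaler0 addr0. Qed.
Lemma triv_linearr x : linear (triv_act x).
Proof. by move=> a m n; rewrite /triv_act scaler0 addr0. Qed.
Lemma triv_lieb x y m :
  triv_act (lieb x y) m = triv_act x (triv_act y m) - triv_act y (triv_act x m).
Proof. by rewrite /triv_act subr0. Qed.

HB.instance Definition _ :=
  @Lmodule_isLieModule.Build K g (trivial_module g) triv_act
    triv_linearl triv_linearr triv_lieb.

End TrivialModule.

Section Submodules.
Variables (K : fieldType) (g : lieAlgType K) (M : lieModType g).

Definition is_submodule (N : set M) : Prop :=
  [/\ N 0, forall a x y, N x -> N y -> N (a *: x + y) &
      forall (u : g) x, N x -> N (lact u x)].

Record submodule := Submodule {
  carrier :> set M;
  submoduleP : is_submodule carrier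
}.

Lemma is_submodule_zero : is_submodule [set 0].
Proof.
split=> [//|a x y -> ->|u x ->]; first by rewrite scaler0 addr0.
exact/linear_at0/lact_linearr.
Qed.
Definition zero_submodule := Submodule is_submodule_zero.

Lemma is_submodule_full : is_submodule [set: M].
Proof. by []. Qed.
Definition full_submodule := Submodule is_submodule_full.

Definition internal_dsum (N A B : set M) : Prop :=
  [/\ is_submodule A, is_submodule B,
      N = [set x | exists2 a, A a & exists2 b, B b & x = a + b] &
      A `&` B = [set 0]].

Definition submodule_pred (N : submodule) : {pred M} := [pred x | `[< carrier N x >]].

Variable N : submodule.

Lemma submodule_predP x : reflect (carrier N x) (x \in submodule_pred N).
Proof. by rewrite inE; exact: asboolP. Qed.

Lemma submodule_pred_closed : submod_closed (submodule_pred N).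
Proof.
have [N0 ND _] := submoduleP N.
split=> [|a x y /submodule_predP Nx /submodule_predP Ny].
  exact/submodule_predP.
by apply/submodule_predP; exact: ND.
Qed.

HB.instance Definition _ :=
  GRing.isSubmodClosed.Build K M (submodule_pred N) submodule_pred_closed.

Record submod := Submod {
  submod_val : M;
  submod_valP : submod_val \in submodule_pred N
}.

HB.instance Definition _ := [isSub for submod_val].
HB.instance Definition _ := [Choice of submod by <:].
HB.instance Definition _ := [SubChoice_isSubLmodule of submod by <:].

Lemma submod_lact_closed (u : g) (x : submod) :
  lact u (val x) \in submodule_pred N.
Proof.
have [_ _ Nact] := submoduleP N.
by apply/submodule_predP/Nact/submodule_predP; exact: valP.
Qed.

Definition submod_act (u : g) (x : submod) : submod :=
  Submod (submod_lact_closed u x).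

Lemma submod_linearl x : linear (submod_act^~ x).
Proof.
by move=> a u w; apply: val_inj; rewrite linearP /=; exact: lact_linearl.
Qed.
Lemma submod_linearr u : linear (submod_act u).
Proof.
move=> a x y; apply: val_inj; rewrite linearP /=.
by rewrite -lact_linearr -(linearP (val : submod -> M)).
Qed.
Lemma submod_lieb u w x :
  submod_act (lieb u w) x =
  submod_act u (submod_act w x) - submod_act w (submod_act u x).
Proof. by apply: val_inj; rewrite raddfB /=; exact: lact_lieb. Qed.

HB.instance Definition _ :=
  @Lmodule_isLieModule.Build K g submod submod_act
    submod_linearl submod_linearr submod_lieb.

Definition quotm : Type := Quotient.quot (submodule_pred N).

HB.instance Definition _ := Quotient.on quotm.
HB.instance Definition _ := GRing.Zmodule.on quotm.

Definition to_quotm (x : M) : quotm := \pi_(Quotient.quot (submodule_pred N)) x.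

Lemma to_quotm_repr (q : quotm) : to_quotm (repr q) = q.
Proof. exact: reprK. Qed.

Lemma to_quotm_eq x y : to_quotm x = to_quotm y <-> carrier N (x - y).
Proof.
split=> [/eqP|Nxy]; last apply/eqP.
  by rewrite -Quotient.idealrBE => /submodule_predP.
by rewrite -Quotient.idealrBE; exact/submodule_predP.
Qed.

Lemma to_quotmD x y : to_quotm (x + y) = to_quotm x + to_quotm y.
Proof. exact: (raddfD \pi_(Quotient.quot (submodule_pred N))). Qed.

Lemma to_quotmN x : to_quotm (- x) = - to_quotm x.
Proof. exact: (raddfN \pi_(Quotient.quot (submodule_pred N))). Qed.

Definition quotm_scale (a : K) (q : quotm) : quotm := to_quotm (a *: repr q).

Lemma to_quotmZ a x : to_quotm (a *: x) = quotm_scale a (to_quotm x).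
Proof.
have [N0 ND _] := submoduleP N.
apply/to_quotm_eq; rewrite -scalerBr -[_ *: _]addr0; apply: ND => //.
by apply/to_quotm_eq; rewrite to_quotm_repr.
Qed.

Lemma quotm_scaleA a b q : quotm_scale a (quotm_scale b q) = quotm_scale (a * b) q.
Proof. by rewrite -[q]to_quotm_repr -!to_quotmZ scalerA. Qed.
Lemma quotm_scale1 : left_id 1 quotm_scale.
Proof. by move=> q; rewrite -[q in LHS]to_quotm_repr -to_quotmZ scale1r to_quotm_repr. Qed.
Lemma quotm_scaleDr : right_distributive quotm_scale +%R.
Proof.
move=> a p q; rewrite -[p]to_quotm_repr -[q]to_quotm_repr.
by rewrite -to_quotmD -!to_quotmZ scalerDr to_quotmD.
Qed.
Lemma quotm_scaleDl q : {morph quotm_scale^~ q : a b / a + b}.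
Proof.
by move=> a b; rewrite -[q]to_quotm_repr -!to_quotmZ scalerDl to_quotmD.
Qed.

HB.instance Definition _ := GRing.Zmodule_isLmodule.Build K quotm
  quotm_scaleA quotm_scale1 quotm_scaleDr quotm_scaleDl.

Lemma to_quotm_linear : linear to_quotm.
Proof. by move=> a x y; rewrite to_quotmD to_quotmZ. Qed.

Definition quotm_act (u : g) (q : quotm) : quotm := to_quotm (lact u (repr q)).

Lemma to_quotm_act u x : to_quotm (lact u x) = quotm_act u (to_quotm x).
Proof.
have [_ _ Nact] := submoduleP N.
apply/to_quotm_eq.
have -> : lact u x - lact u (repr (to_quotm x)) = lact u (x - repr (to_quotm x)).
  by rewrite addrC -scaleN1r -lact_linearr scaleN1r addrC.
by apply/Nact/to_quotm_eq; rewrite to_quotm_repr.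
Qed.

Lemma quotm_linearl q : linear (quotm_act^~ q).
Proof.
move=> a u w; rewrite -[q]to_quotm_repr -!to_quotm_act.
by rewrite -to_quotm_linear -lact_linearl.
Qed.
Lemma quotm_linearr u : linear (quotm_act u).
Proof.
move=> a p q; rewrite -[p]to_quotm_repr -[q]to_quotm_repr.
by rewrite -to_quotm_linear -!to_quotm_act -to_quotm_linear -lact_linearr.
Qed.
Lemma quotm_lieb u w q :
  quotm_act (lieb u w) q =
  quotm_act u (quotm_act w q) - quotm_act w (quotm_act u q).
Proof.
by rewrite -[q]to_quotm_repr -!to_quotm_act lact_lieb to_quotmD to_quotmN.
Qed.

HB.instance Definition _ :=
  @Lmodule_isLieModule.Build K g quotm quotm_act
    quotm_linearl quotm_linearr quotm_lieb.

End Submodules.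

Arguments to_quotm {K g M} N x.
Arguments zero_submodule {K g} M.
Arguments full_submodule {K g} M.

Section Subquotients.
Variables (K : fieldType) (g : lieAlgType K) (M : lieModType g).

Lemma is_submodule_restr (A N : submodule M) :
  is_submodule [set x : submod A | carrier N (val x)].
Proof.
have [N0 ND Nact] := submoduleP N.
split=> [//|a x y Nx Ny|u x Nx]; last exact: Nact.
exact: ND.
Qed.

Definition restr_submodule (A N : submodule M) : submodule (submod A) :=
  Submodule (is_submodule_restr A N).

(* A / N when N is contained in A, and A / (A `&` N) in general. *)
Definition subquot (A N : submodule M) : lieModType g :=
  quotm (restr_submodule A N).

Definition to_subquot (A N : submodule M) (x : submod A) : subquot A N :=
  to_quotm (restr_submodule A N) x.

End Subquotients.

Section Notions.
Variables (K : fieldType) (g : lieAlgType K).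

Definition lie_isomorphism (M M' : lieModType g) (f : M -> M') : Prop :=
  [/\ linear f, forall u x, f (lact u x) = lact u (f x) & bijective f].

Definition lie_isomorphic (M M' : lieModType g) : Prop :=
  exists f : M -> M', lie_isomorphism f.

Definition simple_module (M : lieModType g) : Prop :=
  [set: M] <> [set 0] /\
  forall N : submodule M, N = [set 0] :> set M \/ N = [set: M] :> set M.

Definition semisimple (M : lieModType g) : Prop :=
  exists (I : choiceType) (S : I -> submodule M),
    [/\ forall i, simple_module (submod (S i)),
        forall x, exists (r : seq I) (f : I -> M),
          (forall i, carrier (S i) (f i)) /\ x = \sum_(i <- r) f i &
        forall (r : seq I) (f : I -> M), uniq r -> (forall i, carrier (S i) (f i)) ->
          \sum_(i <- r) f i = 0 -> forall i, i \in r -> f i = 0].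

Definition indecomposable (M : lieModType g) : Prop :=
  [set: M] <> [set 0] /\
  forall A B : submodule M, internal_dsum [set: M] A B ->
    A = [set 0] :> set M \/ B = [set 0] :> set M.

Definition has_length (M : lieModType g) (n : nat) : Prop :=
  exists C : nat -> submodule M,
    [/\ C 0 = [set 0] :> set M, C n = [set: M] :> set M &
        forall i, (i < n)%N ->
          C i `<=` C i.+1 /\ simple_module (subquot (C i.+1) (C i))].

Definition is_socle (M : lieModType g) (S : submodule M) : Prop :=
  semisimple (submod S) /\
  forall N : submodule M, semisimple (submod N) -> N `<=` S.

(* F q is soc^q M: a largest semisimple submodule is unique, so F is determined
   by M. F 0 = 0 is only used to form the first layer F 1 / F 0. *)
Definition socle_filtration (M : lieModType g) (F : nat -> submodule M) : Prop :=
  [/\ F 0 = [set 0] :> set M, is_socle (F 1) &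
      forall q, exists2 S : submodule (quotm (F q.+1)), is_socle S &
        F q.+2 = to_quotm (F q.+1) @^-1` carrier S :> set M].

Definition layer (M : lieModType g) (F : nat -> submodule M) (q : nat) : lieModType g :=
  subquot (F q) (F q.-1).

(* A / N and A' / N' are isomorphic by the map sending the class of x to the
   class of x whenever x lies in both A and A'. *)
Definition naturally_isomorphic (M : lieModType g) (A N A' N' : submodule M) : Prop :=
  exists2 f : subquot A N -> subquot A' N', lie_isomorphism f &
    forall (x : submod A) (y : submod A'), val x = val y ->
      f (to_subquot N x) = to_subquot N' y.

End Notions.

Section Mackey.
Variables (K : fieldType) (V : lmodType K) (B : choiceType) (v : B -> V).

Definition is_basis : Prop :=
  (forall (r : seq B) (c : B -> K), uniq r ->
     \sum_(b <- r) c b *: v b = 0 -> forall b, b \in r -> c b = 0) /\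
  (forall x, exists (r : seq B) (c : B -> K), x = \sum_(b <- r) c b *: v b).

Definition lspan (W : lmodType K) (S : set W) : set W :=
  [set w | exists (n : nat) (c : 'I_n -> K) (u : 'I_n -> W),
     (forall i, S (u i)) /\ w = \sum_(i < n) c i *: u i].

Definition dualV : set (V -> K^o) := [set x | linear x].

(* When v is a basis there is exactly one such x for each b. *)
Definition dual_vector (b : B) : set (V -> K^o) :=
  [set x | dualV x /\ forall a, x (v a) = (a == b)%:R].

Definition V_star : set (V -> K^o) := lspan (\bigcup_b dual_vector b).

Definition V_star_lt (s : nat) : set (V -> K^o) :=
  [set x | dualV x /\ card_lt_aleph [set b | x (v b) != 0] s].

Definition mackey_set : set (V -> V) :=
  [set f | linear f /\ forall x, V_star x -> V_star (x \o f)].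

Lemma lspan_linear (W : lmodType K) (S : set W) a x y :
  lspan S x -> lspan S y -> lspan S (a *: x + y).
Proof.
move=> [n [c [u [Su ->]]]] [m [d [w [Sw ->]]]].
exists (n + m)%N.
exists (fun i => match fintype.split i with inl j => a * c j | inr j => d j end).
exists (fun i => match fintype.split i with inl j => u j | inr j => w j end).
split=> [i|]; first by case: fintype.split.
rewrite big_split_ord /= scaler_sumr; congr (_ + _); apply: eq_bigr => i _.
  by rewrite -[lshift m i]/(unsplit (inl i)) unsplitK scalerA.
by rewrite -[rshift n i]/(unsplit (inr i)) unsplitK.
Qed.

Lemma V_star_dual x : V_star x -> dualV x.
Proof.
move=> [n [c [u [Su ->]]]] a p q; rewrite !fct_sumE scaler_sumr -big_split /=.
apply: eq_bigr => i _; have [b _ [Lu _]] := Su i.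
by rewrite !scalrfctE Lu scalerDr !scalerA mulrC.
Qed.

Lemma V_star0 : V_star 0.
Proof.
by exists 0%N, (fun=> 0), (fun=> 0); split=> [[]//|]; rewrite big_ord0.
Qed.

Definition mackey_pred : {pred V -> V} := [pred f | `[< mackey_set f >]].

Lemma mackey_predP f : reflect (mackey_set f) (f \in mackey_pred).
Proof. by rewrite inE; exact: asboolP. Qed.

Lemma mackey_submod_closed : submod_closed mackey_pred.
Proof.
split=> [|a f h /mackey_predP [Lf Sf] /mackey_predP [Lh Sh]].
  apply/mackey_predP; split=> [a x y|x /V_star_dual Lx].
    by rewrite scaler0 addr0.
  rewrite (_ : _ \o _ = 0); first exact: V_star0.
  by apply/funext => u /=; exact: linear_at0.
apply/mackey_predP; split=> [b x y|x Sx].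
  rewrite !fctE Lf Lh !scalerDr !scalerA addrACA; congr (_ + _ + _).
  by rewrite mulrC.
rewrite (_ : _ \o _ = a *: (x \o f) + (x \o h)).
  by apply: lspan_linear; [exact: Sf|exact: Sh].
by apply/funext => u /=; rewrite (V_star_dual Sx).
Qed.

HB.instance Definition _ :=
  GRing.isSubmodClosed.Build K (V -> V) mackey_pred mackey_submod_closed.

Record mackey := Mackey {
  mackey_val :> V -> V;
  mackey_valP : mackey_val \in mackey_pred
}.

HB.instance Definition _ := [isSub for mackey_val].
HB.instance Definition _ := [Choice of mackey by <:].
HB.instance Definition _ := [SubChoice_isSubLmodule of mackey by <:].

Lemma mackey_comp_closed (f h : mackey) :
  (f \o h : V -> V) \in mackey_pred.
Proof.
have /mackey_predP [Lf Sf] := mackey_valP f.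
have /mackey_predP [Lh Sh] := mackey_valP h.
apply/mackey_predP; split=> [a x y|x Sx] /=; first by rewrite Lh Lf.
exact: (Sh _ (Sf _ Sx)).
Qed.

Definition mackey_comp (f h : mackey) : mackey :=
  Mackey (mackey_comp_closed f h).

Definition mackey_bracket (f h : mackey) : mackey :=
  mackey_comp f h - mackey_comp h f.

Lemma mackey_compDr f a h k :
  mackey_comp f (a *: h + k) = a *: mackey_comp f h + mackey_comp f k.
Proof.
apply: val_inj; rewrite linearP /=; apply/funext => u.
have /mackey_predP [Lf _] := mackey_valP f.
by rewrite /= Lf.
Qed.
Lemma mackey_compDl f a h k :
  mackey_comp (a *: h + k) f = a *: mackey_comp h f + mackey_comp k f.
Proof.
apply: val_inj; rewrite linearP /=; apply/funext => u.
by [].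
Qed.
Lemma mackey_compA f h k :
  mackey_comp f (mackey_comp h k) = mackey_comp (mackey_comp f h) k.
Proof. exact: val_inj. Qed.
Lemma mackey_compBr f h k :
  mackey_comp f (h - k) = mackey_comp f h - mackey_comp f k.
Proof. by rewrite addrC -scaleN1r mackey_compDr scaleN1r addrC. Qed.
Lemma mackey_compBl f h k :
  mackey_comp (h - k) f = mackey_comp h f - mackey_comp k f.
Proof. by rewrite addrC -scaleN1r mackey_compDl scaleN1r addrC. Qed.

Lemma mackey_linearl h : linear (mackey_bracket^~ h).
Proof.
move=> a f k; rewrite /mackey_bracket mackey_compDl mackey_compDr.
by rewrite scalerBr opprD addrACA.
Qed.
Lemma mackey_linearr f : linear (mackey_bracket f).
Proof.
move=> a h k; rewrite /mackey_bracket mackey_compDl mackey_compDr.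
by rewrite scalerBr opprD addrACA.
Qed.
Lemma mackey_bracketxx f : mackey_bracket f f = 0.
Proof. exact: subrr. Qed.
Lemma mackey_jacobi f h k :
  mackey_bracket f (mackey_bracket h k) + mackey_bracket h (mackey_bracket k f)
  + mackey_bracket k (mackey_bracket f h) = 0.
Proof.
have E (p q r s : mackey) : p - q - (r - s) = (p + s) - (q + r).
  by rewrite opprB addrACA -opprD.
rewrite /mackey_bracket !mackey_compBr !mackey_compBl !mackey_compA !E.
have T (p q r : mackey) : p - q + (q - r) + (r - p) = 0.
  by rewrite [X in X + _]addrA subrK addrA subrK subrr.
rewrite [mackey_comp (mackey_comp h k) f + _]addrC.
rewrite [mackey_comp (mackey_comp k f) h + _]addrC.
by rewrite [mackey_comp (mackey_comp k h) f + _]addrC.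
Qed.

HB.instance Definition _ :=
  @Lmodule_isLieAlgebra.Build K mackey mackey_bracket
    mackey_linearl mackey_linearr mackey_bracketxx mackey_jacobi.

Definition scalars : set mackey :=
  [set f | exists a : K, val f = fun u => a *: u].

(* The image in End(V) of w_1 (x) x_1 + ... + w_n (x) x_n. *)
Definition tensor_endo (n : nat) (w : 'I_n -> V) (x : 'I_n -> V -> K^o) :
  V -> V := fun u => \sum_(i < n) (x i u : K) *: w i.

Definition gl_fin : set mackey :=
  [set f | exists (n : nat) (w : 'I_n -> V) (x : 'I_n -> V -> K^o),
     (forall i, V_star (x i)) /\ val f = tensor_endo w x].

(* The kernel of the evaluation pairing V (x) V_* -> K, inside End(V).  Since
   V (x) V_* embeds in End(V), the sum below only depends on f. *)
Definition sl_fin : set mackey :=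
  [set f | exists (n : nat) (w : 'I_n -> V) (x : 'I_n -> V -> K^o),
     [/\ forall i, V_star (x i), val f = tensor_endo w x &
         \sum_(i < n) x i (w i) = 0]].

Definition mackey_lt (s : nat) : set mackey :=
  [set f | forall x, dualV x -> V_star_lt s (x \o val f)].

End Mackey.

Arguments scalars {K V B} v _.
Arguments gl_fin {K V B} v _.
Arguments sl_fin {K V B} v _.
Arguments mackey_lt {K V B} v s _.

(* Main.v *)
(* Elements of the Mackey Lie algebra are the row- and column-finite matrices
   over B.  Such a matrix lies in gl^M_s iff it has fewer than aleph_s nonzero
   columns: among infinitely many nonzero columns one finds equally many with
   disjoint supports, and a functional that is nonzero on all of these.

   The heart of the matter is that an ideal I containing some f outside
   C id + gl^M_s contains every g with at most aleph_s nonzero columns.  First,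
   f is replaced by an element with aleph_s nonzero off-diagonal columns (if f is
   essentially diagonal, take its commutator with a sum of units e_{ab}, f_aa <> f_bb).
   A sparse choice of off-diagonal entries and two commutators with projections
   put into I a partial injection s : E -> B, with s(E) disjoint from E and
   |E| = aleph_s.  Multiplying by partial injections on both sides gives all g whose
   sets of row and column indices are disjoint, and the Eilenberg swindle writes
   a diagonal block as a commutator with an element of this kind.  The same steps
   with a one-element E show that an ideal not contained in C id contains sl.

   Hence the submodules containing C id form the chain C id, C id + sl,
   C id + gl^M_0, ..., C id + gl^M_t, gl^M, which yields the socle filtration
   and the length. *)

From HB Require Import structures.
Require Import Defs.
From mathcomp Require Import all_boot all_algebra.
From mathcomp Require Import boolp classical_sets functions cardinality.
From mathcomp Require Import reals complex.

Set Implicit Arguments.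
Unset Strict Implicit.
Unset Printing Implicit Defensive.

Import GRing.Theory Num.Theory.
Local Open Scope classical_set_scope.
Local Open Scope card_scope.
Local Open Scope ring_scope.

(** * Infinite cardinals *)

Section Cardinals.

(** Submodules of the adjoint module are only Lie ideals, and a Lie ideal is not closed under the
    associative product. A product [f * g] is available when [g * f = 0], for then it is a
    commutator. This is why row sets, column sets and the domain [E] are kept disjoint throughout,
    and why diagonal blocks, where no such vanishing holds, need a device of their own. No ordinals
    occur. Comparability of cardinals, absorption of a factor nat, sparse subfamilies and the
    pairing of distinct diagonal values all come from maximal disjoint families, that is, from
    Zorn's lemma in [max_disjoint]. The submodules are not linearly ordered as a whole: C id and sl
    are incomparable. Both are simple and make up the first socle layer, so a module of length t+4
    has a socle filtration with t+3 layers. *)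

Lemma card_le_injOn (T U : Type) (A : set T) (B : set U) (f : T -> U) :
  set_fun A B f -> set_inj A f -> A #<= B.
Proof.
move=> fAB fI.
have /injfunPex [g] : exists2 g : T -> U, set_fun A B g & set_inj A g by exists f.
exact: inj_card_le.
Qed.

(** The comparison yields an injection between subtypes; a total function is easier to compose and
    to pair, and [y] is its junk value off [A]. *)
Lemma card_le_ex (T U : Type) (A : set T) (B : set U) (y : U) :
  A #<= B -> exists2 f : T -> U, set_fun A B f & set_inj A f.
Proof.
move=> /card_leP /injfunPex [f _ fI].
pose g x := if pselect (A x) is left Ax then val (f (exist _ x (mem_set Ax))) else y.
have gE x (Ax : A x) : g x = val (f (exist _ x (mem_set Ax))).
  by rewrite /g; case: pselect => // Ax'; congr (val (f (exist _ _ _))); exact: Prop_irrelevance.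
exists g => [x Ax|x x' /set_mem Ax /set_mem Ax'].
  by rewrite gE; exact: set_valP.
by rewrite !gE => /val_inj /fI; rewrite !in_setE => /(_ I I) [].
Qed.

(** Zorn's lemma for disjoint subfamilies. An empty [F i] meets nothing, not even itself, hence the
    nonemptiness condition in the maximality clause. *)
Lemma max_disjoint (I T : Type) (F : I -> set T) (D : set I) :
  exists E, [/\ E `<=` D, trivIset E F &
    forall i, D i -> F i !=set0 -> exists2 j, E j & (F i `&` F j) !=set0].
Proof.
have [E [ED EF Emax]] := ex_maximal_disjoint_subcollection F D.
exists E; split=> // i Di [z Fiz].
have [Ei|nEi] := pselect (E i); first by exists i => //; exists z.
apply: contrapT => nj; apply: (Emax (i |` E)).
- by split=> [|/(_ i)]; [exact: subsetUr|move/(_ (or_introl erefl))].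
- by move=> k [->|/ED].
- move=> j k [->|Ej] [->|Ek] //; last exact: EF.
  + by move=> h; case: nj; exists k.
  + by rewrite setIC => h; case: nj; exists j.
Qed.

(** A disjoint family of sets [[set inl x; inr y]] is the graph of a partial injection between [A]
    and [B]. If a maximal one misses some [x] in [A], it cannot also miss some [y] in [B], since
    [(x, y)] could be added. *)
Lemma card_le_total (T U : Type) (A : set T) (B : set U) : A #<= B \/ B #<= A.
Proof.
pose F (p : T * U) : set (T + U) := [set inl p.1; inr p.2].
have [E [EAB EF Emax]] := max_disjoint F (A `*` B).
have E1 p q : E p -> E q -> p.1 = q.1 -> p = q.
  by move=> Ep Eq e; apply: EF => //; exists (inl p.1); split; left; rewrite ?e.
have E2 p q : E p -> E q -> p.2 = q.2 -> p = q.
  by move=> Ep Eq e; apply: EF => //; exists (inr p.2); split; right; rewrite ?e.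
have [Acov|/existsNP [x /not_implyP [Ax nx]]] :=
    pselect (forall x, A x -> exists y, E (x, y)).
  left; have [->|/set0P [x0 Ax0]] := eqVneq A set0; first exact: card_ge0.
  have [y0 _] := Acov _ Ax0.
  have [f fE] : {f : T -> U & forall x, A x -> E (x, f x)}.
    by apply: (@choice _ _ (fun x y => A x -> E (x, y))) => x;
      have [/Acov [y Exy]|] := pselect (A x); [exists y|exists y0].
  apply: (@card_le_injOn _ _ _ _ f) => [x /fE /EAB []//|].
  move=> x x' /set_mem /fE Ex /set_mem /fE Ex' e.
  by have [] := E2 _ _ Ex Ex' e.
right; have Bcov y : B y -> exists x', E (x', y).
  move=> By; have [|[x' y'] Exy] := Emax (x, y) (conj Ax By).
    by exists (inl x); left.
  case=> z [] [->|->] /= [] //= [e]; first by case: nx; exists y'; rewrite e.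
  by exists x'; rewrite e.
have [->|/set0P [y0 By0]] := eqVneq B set0; first exact: card_ge0.
have [f fE] : {f : U -> T & forall y, B y -> E (f y, y)}.
  by apply: (@choice _ _ (fun y x => B y -> E (x, y))) => y;
    have [/Bcov [x' Exy]|] := pselect (B y); [exists x'|exists x].
apply: (@card_le_injOn _ _ _ _ f) => [y /fE /EAB []//|].
move=> y y' /set_mem /fE Ey /set_mem /fE Ey' e.
by have [] := E1 _ _ Ey Ey' e.
Qed.

(* A is, up to a finite set, a disjoint union of infinite sequences. *)
Lemma card_mul_nat (T : Type) (A : set T) :
  infinite_set A -> A `*` [set: nat] #<= A.
Proof.
move=> Ainf.
(* The sequences form a maximal family [J] with disjoint ranges. An infinite leftover [Z] would
   contain one more injective sequence. *)
pose S := [set u : nat -> T | injective u /\ range u `<=` A].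
have [J [JS JF Jmax]] := max_disjoint (fun u : nat -> T => range u) S.
have Jd u u' n n' : J u -> J u' -> u n = u' n' -> u = u' /\ n = n'.
  move=> Ju Ju' e; have uu' : u = u'.
    by apply: JF => //; exists (u n); split; [exists n|exists n' => //; rewrite e].
  by split=> //; move: e; rewrite -uu'; apply: (JS _ Ju).1.
pose Z := A `\` \bigcup_(u in J) range u.
have Zfin : finite_set Z.
  apply: contrapT => /infiniteP.
  have [x0 _] := infinite_setN0 Ainf.
  move=> /(card_le_ex x0) [u uZ uI].
  have Su : S u.
    split; first by move=> n n' /uI; rewrite !in_setE; exact.
    by move=> _ [n _ <-]; exact: (uZ n I).1.
  have [|w Jw [_ [[n _ <-] [m _ e]]]] := Jmax u Su; first by exists (u 0%N), 0%N.
  by case: (uZ n I).2; exists w => //; exists m.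
have [u0 Ju0] : J !=set0.
  apply/set0P/eqP => J0; apply: Ainf; apply: sub_finite_set Zfin => x Ax.
  by split=> // -[u]; rewrite J0.
have [m] := Zfin; rewrite card_eq_le => /andP[/(card_le_ex 0%N) [r rm rI] _].
have [c cP] : {c : T -> (nat -> T) * nat * bool & forall x, A x ->
    J (c x).1.1 /\ if (c x).2 then Z x /\ r x = (c x).1.2
                  else (c x).1.1 (c x).1.2 = x}.
  apply: (@choice _ _ (fun x p => A x -> J p.1.1 /\
    if p.2 then Z x /\ r x = p.1.2 else p.1.1 p.1.2 = x)) => x.
  have [[u Ju [n _ <-]]|nx] := pselect ((\bigcup_(u in J) range u) x).
    by exists (u, n, false).
  by exists (u0, r x, true).
(* [(x, k)] goes to the sequence through [x], at a position coding the old position of [x] and [k].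
   Points of [Z] borrow the sequence [u0], with their rank [r x] as position; the boolean separates
   them from the genuine members of [u0]. *)
pose f (p : T * nat) := (c p.1).1.1 (pickle ((c p.1).1.2, (c p.1).2, p.2)).
apply: (@card_le_injOn _ _ _ _ f) => [[x k] [/= Ax _]|].
  by have [Jc _] := cP x Ax; apply: (JS _ Jc).2; exists (pickle ((c x).1.2, (c x).2, k)).
move=> [x k] [x' k'] /set_mem [/= Ax _] /set_mem [/= Ax' _].
have [Jc cx] := cP x Ax; have [Jc' cx'] := cP x' Ax'.
rewrite /f /= => /(Jd _ _ _ _ Jc Jc') [eu /(pcan_inj pickleK) [en eb ek]].
move: cx cx'; rewrite eu en eb; case: (c x').2 => [[Zx rx] [Zx' rx']|-> ->].
  by congr (_, _) => //; apply: rI; rewrite ?in_setE ?rx.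
by rewrite ek.
Qed.

(* X may be finite, so it is D that absorbs the factor nat enumerating the F i. *)
Lemma card_le_bigcup (I T U : Type) (D : set U) (X : set I) (F : I -> set T) :
  infinite_set D -> X #<= D -> (forall i, X i -> finite_set (F i)) ->
  \bigcup_(i in X) F i #<= D.
Proof.
move=> Dinf XD Ffin; apply: card_le_trans (card_mul_nat Dinf).
have [y0 _] := infinite_setN0 Dinf.
have [g gD gI] := card_le_ex y0 XD.
have [r rP] : {r : I -> T -> nat & forall i, X i -> set_inj (F i) (r i)}.
  apply: (@choice _ _ (fun i r => X i -> set_inj (F i) r)) => i.
  have [/Ffin [m]|nXi] := pselect (X i); last by exists (fun=> 0%N).
  by rewrite card_eq_le => /andP[/(card_le_ex 0%N) [r _ rI] _]; exists r.
have [c cP] : {c : T -> U * nat & forall x, (\bigcup_(i in X) F i) x ->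
    exists i, [/\ X i, F i x & c x = (g i, r i x)]}.
  apply: (@choice _ _ (fun x p => (\bigcup_(i in X) F i) x ->
    exists i, [/\ X i, F i x & p = (g i, r i x)])) => x.
  have [[i Xi Fix]|nx] := pselect ((\bigcup_(i in X) F i) x); last by exists (y0, 0%N).
  by exists (g i, r i x) => _; exists i.
apply: (@card_le_injOn _ _ _ _ c) => [x /cP [i [Xi _ ->]]|x x'].
  by split=> //=; exact: gD.
move=> /set_mem /cP [i [Xi Fix ->]] /set_mem /cP [i' [Xi' Fix' ->]] [ei er].
have ii' : i = i' by apply: gI; rewrite ?in_setE.
by subst i'; apply: (rP i Xi) er; rewrite in_setE.
Qed.

(** The injections of [A] and [A'] into [D] have fibres of at most one point, so the union is a
    union over [D] of finite sets. *)
Lemma card_leU (T U : Type) (D : set U) (A A' : set T) :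
  infinite_set D -> A #<= D -> A' #<= D -> A `|` A' #<= D.
Proof.
move=> Dinf AD A'D.
have [y0 _] := infinite_setN0 Dinf.
have [f fD fI] := card_le_ex y0 AD; have [g gD gI] := card_le_ex y0 A'D.
pose F (y : U) : set T := (A `&` f @^-1` [set y]) `|` (A' `&` g @^-1` [set y]).
have fin1 (h : T -> U) (X : set T) y : set_inj X h -> finite_set (X `&` h @^-1` [set y]).
  move=> hI; apply: (@card_le_finite _ _ _ [set y]) (finite_set1 y).
  apply: (@card_le_injOn _ _ _ _ h) => [x [//]|x x' /set_mem [Xx _] /set_mem [Xx' _]].
  by apply: hI; rewrite in_setE.
apply: card_le_trans (@card_le_bigcup _ _ _ D D F Dinf (card_lexx _) _).
  apply: subset_card_le => x [Ax|A'x].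
    by exists (f x); [exact: fD|left].
  by exists (g x); [exact: gD|right].
by move=> y _; rewrite finite_setU; split; exact: fin1.
Qed.

(** If the larger of the two sets is infinite, it dominates the union; if it is finite, so is the
    union, which then cannot dominate [D]. *)
Lemma card_geU (T U : Type) (D : set U) (A A' : set T) :
  infinite_set D -> D #<= A `|` A' -> D #<= A \/ D #<= A'.
Proof.
wlog AA' : A A' / A #<= A'.
  move=> hw Dinf DAA'; have [h|h] := card_le_total A A'; first exact: hw.
  by have [] := hw A' A h Dinf; rewrite 1?setUC //; [right|left].
move=> Dinf DAA'; right; apply: (card_le_trans DAA').
have [A'fin|] := pselect (finite_set A'); last first.
  by move=> A'inf; exact: card_leU.
have AUfin : finite_set (A `|` A').
  by rewrite finite_setU; split=> //; exact: card_le_finite A'fin.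
by case: Dinf; exact: card_le_finite DAA' AUfin.
Qed.

(** An injection of [D] x nat into [D] gives disjoint copies of [D] inside [D]: copy 0 is one half,
    and its complement contains copy 1. *)
Lemma halves (T : Type) (D : set T) : infinite_set D ->
  exists D1 D2, [/\ D = D1 `|` D2, D1 `&` D2 = set0, D #<= D1 & D #<= D2].
Proof.
move=> Dinf; have [y0 _] := infinite_setN0 Dinf.
have [f fD fI] := card_le_ex y0 (card_mul_nat Dinf).
pose h n x := f (x, n).
have hI n : set_inj D (h n).
  by move=> x x' /set_mem Dx /set_mem Dx' /fI; rewrite !in_setE => /(_ (conj Dx I) (conj Dx' I)) [].
exists (h 0%N @` D), (D `\` h 0%N @` D); split.
- by rewrite setUIr setUCr setIT; apply/esym/setUidPr => _ [x Dx <-]; exact: fD.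
- by rewrite setDE setIC -setIA setICl setI0.
- apply: (@card_le_injOn _ _ _ _ (h 0%N)) => // x Dx; exact: imageP.
- apply: (@card_le_injOn _ _ _ _ (h 1%N)) => // x Dx; split; first exact: fD.
  by move=> [x' Dx' /fI]; rewrite !in_setE => /(_ (conj Dx' I) (conj Dx I)) [].
Qed.

(** For a maximal disjoint subfamily [D], every [F i] meets some [F j] with [j] in [D]. For fixed
    [j] only finitely many [i] do so, because [F j] is finite and each point lies in finitely many
    [F i]. Hence [C] is covered by finite sets indexed by [D]. *)
Lemma sparse_subset (I T : Type) (C : set I) (F : I -> set T) :
  infinite_set C -> (forall i, C i -> F i !=set0) ->
  (forall i, C i -> finite_set (F i)) ->
  (forall z, finite_set [set i | C i /\ F i z]) ->
  exists D, [/\ D `<=` C, trivIset D F & C #<= D].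
Proof.
move=> Cinf F0 Ffin Ffin'; have [D [DC DF Dmax]] := max_disjoint F C.
pose N j := \bigcup_(z in F j) [set i | C i /\ F i z].
have CN : C `<=` \bigcup_(j in D) N j.
  move=> i Ci; have [j Dj [z [Fiz Fjz]]] := Dmax i Ci (F0 i Ci).
  by exists j => //; exists z.
have Nfin j : D j -> finite_set (N j).
  by move=> Dj; apply: bigcup_finite => [|z _]; [exact/Ffin/DC|exact: Ffin'].
exists D; split=> //; apply: card_le_trans (subset_card_le CN) _.
apply: card_le_bigcup => //; apply: contra_not Cinf => Dfin.
by apply: (sub_finite_set CN); exact: bigcup_finite.
Qed.

End Cardinals.

(** * The cardinals aleph_s compared across types *)

Section Alephs.

Lemma card_ltP (T U : Type) (A : set T) (B : set U) : card_lt A B <-> ~ (B #<= A).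
Proof.
split=> [/andP[_ /negP]//|nBA]; apply/andP; split; last exact/negP.
by have [] := card_le_total A B.
Qed.

Lemma has_aleph_infinite (T : Type) s (D : set T) : has_aleph s D -> infinite_set D.
Proof.
elim: s D => [|s IHs] D /=.
  by rewrite card_eq_le => /andP[_] /infiniteP.
by move=> [D' [D'D /IHs D'inf _ _]]; apply: contra_not D'inf; exact: sub_finite_set.
Qed.

(** If [D] were not below [E], a copy of [E] inside [D] would be strictly smaller than [D], hence at
    most [D'], hence at most [E'] by induction, although [E'] is strictly smaller than [E]. *)
Lemma has_aleph_le (T U : Type) s (D : set T) (E : set U) :
  has_aleph s D -> has_aleph s E -> D #<= E.
Proof.
elim: s T U D E => [|s IHs] T U D E /=.
  rewrite card_eq_le => /andP[Dn _]; rewrite card_eq_le => /andP[_ nE].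
  exact: card_le_trans nE.
move=> [D' [D'D aD' _ Dmax]] [E' [E'E aE' /card_ltP nEE' _]].
apply: contrapT => nDE.
have [|ED] := card_le_total D E; first exact.
have [x0 _] := infinite_setN0 (has_aleph_infinite aD').
have [f fD fI] := card_le_ex x0 ED.
have Ef : E #<= f @` E by apply: (@card_le_injOn _ _ _ _ f) => // x Ex; exact: imageP.
apply: nEE'; apply: card_le_trans Ef (card_le_trans _ (IHs _ _ _ _ aD' aE')).
apply: Dmax => [_ [x Ex <-]|]; first exact: fD.
by apply/card_ltP => Df; apply: nDE; exact: card_le_trans (card_image_le f E).
Qed.

Lemma has_aleph_sub (T : Type) t s (D : set T) :
  (s <= t)%N -> has_aleph t D -> exists2 E, E `<=` D & has_aleph s E.
Proof.
elim: t D => [|t IHt] D; first by rewrite leqn0 => /eqP ->; exists D.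
rewrite leq_eqVlt => /predU1P[->|]; first by exists D.
rewrite ltnS => st [D' [D'D /(IHt _ st) [E ED' aE] _ _]].
by exists E => //; exact: subset_trans D'D.
Qed.

Lemma card_lt_alephP (T U : Type) s (A : set T) (D : set U) :
  has_aleph s D -> card_lt_aleph A s <-> ~ (D #<= A).
Proof.
move=> aD; split=> [[W [E [aE /card_ltP nEA]]]|nDA]; last first.
  by exists U, D; split=> //; exact/card_ltP.
by apply: contra_not nEA; exact: card_le_trans (has_aleph_le aE aD).
Qed.

(** The successor property, carried from subsets of [E] to arbitrary sets by an injection. [E]
    certifies that a set of cardinal aleph_(s+1) exists in some type, as [card_lt_aleph] demands. *)
Lemma card_lt_alephSP (T U W : Type) s (A : set T) (D : set U) (E : set W) :
  has_aleph s.+1 E -> has_aleph s D -> card_lt_aleph A s.+1 <-> A #<= D.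
Proof.
move=> aE aD; rewrite (card_lt_alephP A aE).
have [E' [E'E aE' /card_ltP nEE' Emax]] := aE.
split=> [nEA|AD]; last first.
  apply: contra_not nEE' => EA; apply: card_le_trans EA (card_le_trans AD _).
  exact: has_aleph_le aD aE'.
have [EA|AE] := card_le_total E A; first by case: nEA.
have [x0 _] := infinite_setN0 (has_aleph_infinite aE).
have [f fE fI] := card_le_ex x0 AE.
have Af : A #<= f @` A by apply: (@card_le_injOn _ _ _ _ f) => // x Ax; exact: imageP.
apply: card_le_trans Af (card_le_trans _ (has_aleph_le aE' aD)).
apply: Emax => [_ [x Ax <-]|]; first exact: fE.
by apply/card_ltP => Ef; apply: nEA; exact: card_le_trans (card_image_le f A).
Qed.

End Alephs.

(** * Socles and subquotients of Lie modules *)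

Section Submodules.
Variables (K : fieldType) (g : lieAlgType K).
Implicit Types M : lieModType g.

Section Closure.
Variables (M : lieModType g) (N : set M).
Hypothesis NP : is_submodule N.

Lemma submodule0 : N 0. Proof. by case: NP. Qed.
Lemma submoduleD x y : N x -> N y -> N (x + y).
Proof. by move=> Nx Ny; case: NP => _ ND _; rewrite -[x]scale1r; exact: ND. Qed.
Lemma submoduleZ a x : N x -> N (a *: x).
Proof. by move=> Nx; case: NP => N0 ND _; rewrite -[_ *: _]addr0; exact: ND. Qed.
Lemma submoduleN x : N x -> N (- x).
Proof. by move=> Nx; rewrite -scaleN1r; exact: submoduleZ. Qed.
Lemma submoduleB x y : N x -> N y -> N (x - y).
Proof. by move=> Nx /submoduleN; exact: submoduleD. Qed.
Lemma submodule_act u x : N x -> N (lact u x).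
Proof. by case: NP => _ _; exact. Qed.
Lemma submodule_sum (J : Type) (r : seq J) (P : pred J) (F : J -> M) :
  (forall j, P j -> N (F j)) -> N (\sum_(j <- r | P j) F j).
Proof.
by move=> NF; elim/big_ind: _ => //; [exact: submodule0|exact: submoduleD].
Qed.

End Closure.

(** Same shape as the sum in [internal_dsum], so that direct sum decompositions hold by
    unfolding. *)
Definition sum_set M (A C : set M) : set M :=
  [set x | exists2 a, A a & exists2 c, C c & x = a + c].

Lemma sum_set_submodule M (A C : set M) :
  is_submodule A -> is_submodule C -> is_submodule (sum_set A C).
Proof.
move=> Asub Csub; split.
- by exists 0; [exact: submodule0|exists 0; [exact: submodule0|rewrite addr0]].
- move=> k _ _ [a Aa [c Cc ->]] [a' Aa' [c' Cc' ->]].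
  exists (k *: a + a'); first by apply: submoduleD => //; exact: submoduleZ.
  exists (k *: c + c'); first by apply: submoduleD => //; exact: submoduleZ.
  by rewrite scalerDr addrACA.
- move=> u _ [a Aa [c Cc ->]]; exists (lact u a); first exact: submodule_act.
  exists (lact u c); first exact: submodule_act.
  by have := lact_linearr u 1 a c; rewrite !scale1r.
Qed.

Lemma sum_setl M (A C : set M) : is_submodule C -> A `<=` sum_set A C.
Proof. by move=> Csub x Ax; exists x => //; exists 0; [exact: submodule0|rewrite addr0]. Qed.

Lemma sum_setr M (A C : set M) : is_submodule A -> C `<=` sum_set A C.
Proof. by move=> Asub x Cx; exists 0; [exact: submodule0|exists x => //; rewrite add0r]. Qed.

Lemma sum_set_sub M (A C N : set M) : is_submodule N ->
  A `<=` N -> C `<=` N -> sum_set A C `<=` N.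
Proof.
by move=> NP AN CN _ [a /AN Na [c /CN Nc ->]]; exact: submoduleD.
Qed.

(** Simplicity of [submod S] phrased inside [M], which avoids nested subtypes; [simple_submodP]
    translates. *)
Definition simple_sub M (S : submodule M) : Prop :=
  (exists2 x, carrier S x & x <> 0) /\
  forall P : submodule M, P `<=` S -> forall x, carrier P x -> x <> 0 -> S `<=` P.

Lemma lift_is_submodule M (T : submodule M) (P : submodule (submod T)) :
  is_submodule [set x | exists2 y, carrier P y & val y = x].
Proof.
have PP := submoduleP P; split.
- by exists 0; [exact: submodule0|].
- move=> a _ _ [x Px <-] [y Py <-]; exists (a *: x + y); last by rewrite linearP.
  by apply: submoduleD => //; exact: submoduleZ.
- by move=> u _ [x Px <-]; exists (lact u x); [exact: submodule_act|].
Qed.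

Definition lift_submodule M (T : submodule M) (P : submodule (submod T)) :=
  Submodule (lift_is_submodule P).

Lemma lift_submodule_sub M (T : submodule M) (P : submodule (submod T)) :
  lift_submodule P `<=` T.
Proof. by move=> _ [y _ <-]; apply/submodule_predP/valP. Qed.

Definition insubmod M (T : submodule M) x (Tx : carrier T x) : submod T :=
  Submod (introT (submodule_predP T x) Tx).

Lemma simple_submodP M (S : submodule M) :
  simple_module (submod S) <-> simple_sub S.
Proof.
split=> [[S0 Ssimp]|[[x Sx x0] Ssimp]].
  split.
    apply: contrapT => nx; apply: S0; apply/seteqP; split=> // y _ /=.
    apply: contrapT => y0; apply: nx; exists (val y); first exact/submodule_predP/valP.
    by move=> vy; apply: y0; apply: val_inj; rewrite vy.
  move=> P PS x Px x0 y Sy.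
  have [e|e] := Ssimp (restr_submodule S P).
    have : carrier (restr_submodule S P) (insubmod (PS _ Px)) by [].
    by rewrite e => /(congr1 val).
  by have : carrier (restr_submodule S P) (insubmod Sy) by rewrite e.
split=> [e|P].
  have : [set: submod S] (insubmod Sx) by [].
  by rewrite e => /(congr1 val).
have [P0|nP0] := pselect (P `<=` [set 0]).
  left; apply/seteqP; split=> // _ ->; exact: (submodule0 (submoduleP _)).
right; apply/seteqP; split=> // z _.
have [y Py y0] : exists2 y, carrier P y & y <> 0.
  by apply: contrapT => ny; apply: nP0 => y Py; apply: contrapT => y0; apply: ny; exists y.
have Sz : carrier S (val z) by exact/submodule_predP/valP.
have vy0 : val y <> 0 by move=> vy; apply: y0; exact: val_inj.
by have [w Pw /val_inj <-] := Ssimp (lift_submodule P) (@lift_submodule_sub _ _ P)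
  (val y) (ex_intro2 _ _ y Py erefl) vy0 _ Sz.
Qed.

Lemma simple_lift M (T : submodule M) (P : submodule (submod T)) :
  simple_sub P -> simple_sub (lift_submodule P).
Proof.
move=> [[x Px x0] Psimp]; split.
  by exists (val x); [exists x|move=> vx; apply: x0; exact: val_inj].
move=> Q QP y Qy y0 _ [w Pw <-].
have [z Pz zy] := QP _ Qy.
have := Psimp (restr_submodule T Q) _ z _ _ w Pw; apply.
- by move=> s /QP [s' Ps' /val_inj <-].
- by rewrite /= zy.
- by move=> z0; apply: y0; rewrite -zy z0.
Qed.

Lemma simple_restr M (T S : submodule M) : S `<=` T ->
  simple_sub S -> simple_sub (restr_submodule T S).
Proof.
move=> ST [[x Sx x0] Ssimp]; split.
  by exists (insubmod (ST _ Sx)) => // /(congr1 val).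
move=> Q QS y Qy y0 z Sz.
have := Ssimp (lift_submodule Q) _ (val y) _ _ (val z) Sz.
have h : lift_submodule Q `<=` S by move=> _ [s Qs <-]; exact: (QS s Qs).
have h2 : val y <> 0 by move=> vy; apply: y0; exact: val_inj.
by case/(_ h (ex_intro2 _ _ y Qy erefl) h2) => w Qw /val_inj <-.
Qed.

(* Void families are allowed: they give the socle of the zero module. *)
Lemma is_socle_of_simples M (I : choiceType) (S : I -> submodule M) (T : submodule M) :
  (forall i, simple_sub (S i)) -> (forall i, S i `<=` T) ->
  (forall x, carrier T x -> exists (r : seq I) (f : I -> M),
     (forall i, carrier (S i) (f i)) /\ x = \sum_(i <- r) f i) ->
  (forall (r : seq I) (f : I -> M), uniq r -> (forall i, carrier (S i) (f i)) ->
     \sum_(i <- r) f i = 0 -> forall i, i \in r -> f i = 0) ->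
  (forall (P : submodule M) x, carrier P x -> x <> 0 -> exists i, S i `<=` P) ->
  is_socle T.
Proof.
move=> Ssimp ST Sspan Sfree Smin; split.
  exists I, (fun i => restr_submodule T (S i)); split.
  - by move=> i; apply/simple_submodP/simple_restr.
  - move=> x; have [r [f [Sf xE]]] := Sspan (val x) (submodule_predP _ _ (valP x)).
    exists r, (fun i => insubmod (ST _ _ (Sf i))); split=> //.
    by apply: val_inj; rewrite raddf_sum.
  - move=> r f ru Sf f0 i ir; apply: val_inj.
    apply: (Sfree r (fun i => val (f i))) => //.
    by rewrite -raddf_sum f0.
move=> N [J [Q [Qsimp Qspan _]]] x Nx.
(* Each simple summand [Q j] of a competing semisimple [N] contains some [S i], hence equals it by
   simplicity and lies in [T]. *)
have QT j : lift_submodule (Q j) `<=` T.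
  have /simple_submodP/simple_lift [[y Qy y0] Qs] := Qsimp j.
  have [i SQ] := Smin _ _ Qy y0.
  have [[z Sz z0] _] := Ssimp i.
  exact: subset_trans (Qs (S i) SQ z Sz z0) (ST i).
have [r [f [Qf xE]]] := Qspan (insubmod Nx).
have -> : x = val (insubmod Nx) by [].
rewrite xE raddf_sum; apply: submodule_sum; first exact: submoduleP.
by move=> j _; apply: (QT j); exists (f j).
Qed.

Section Quotients.
Variables (M : lieModType g) (N : submodule M).

Lemma to_quotm0 : to_quotm N 0 = 0.
Proof. exact/linear_at0/to_quotm_linear. Qed.

Lemma to_quotm_eq0 x : to_quotm N x = 0 <-> carrier N x.
Proof. by rewrite -to_quotm0 to_quotm_eq subr0. Qed.

Lemma image_is_submodule (A : submodule M) :
  is_submodule [set q | exists2 x, carrier A x & to_quotm N x = q].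
Proof.
have AP := submoduleP A; split.
- by exists 0; [exact: submodule0|exact: to_quotm0].
- move=> a _ _ [x Ax <-] [y Ay <-]; exists (a *: x + y).
    by apply: submoduleD => //; exact: submoduleZ.
  exact: to_quotm_linear.
- move=> u _ [x Ax <-]; exists (lact u x); first exact: submodule_act.
  exact: to_quotm_act.
Qed.

Definition image_submodule (A : submodule M) := Submodule (image_is_submodule A).

Lemma preimage_is_submodule (Q : submodule (quotm N)) :
  is_submodule [set x | carrier Q (to_quotm N x)].
Proof.
have QP := submoduleP Q; split.
- by rewrite /= to_quotm0; exact: submodule0.
- move=> a x y /= Qx Qy; rewrite to_quotm_linear.
  by apply: submoduleD => //; exact: submoduleZ.
- by move=> u x /= Qx; rewrite to_quotm_act; exact: submodule_act.
Qed.

Definition preimage_submodule (Q : submodule (quotm N)) :=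
  Submodule (preimage_is_submodule Q).

Lemma sub_preimage_submodule (Q : submodule (quotm N)) : N `<=` preimage_submodule Q.
Proof.
by move=> x /to_quotm_eq0 /= ->; exact: (submodule0 (submoduleP _)).
Qed.

Lemma preimage_image_submodule (A : submodule M) : N `<=` A ->
  to_quotm N @^-1` image_submodule A = A.
Proof.
move=> NA; apply/seteqP; split=> [x [y Ay /to_quotm_eq Nyx]|x Ax]; last by exists x.
have -> : x = y - (y - x) by rewrite opprB addrC subrK.
by apply: submoduleB => //; [exact: submoduleP|exact: NA].
Qed.

(** The hypotheses put [A / N] inside every nonzero submodule of the quotient. It is therefore the
    only simple submodule, and the socle is the sum of a family with one member. *)
Lemma is_socle_quotm (A : submodule M) :
  N `<=` A -> ~ (A `<=` N) ->
  (forall (P : submodule M) x, N `<=` P -> carrier P x -> ~ carrier N x -> A `<=` P) ->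
  exists2 S : submodule (quotm N), is_socle S & A = to_quotm N @^-1` S :> set M.
Proof.
move=> NA nAN Amin.
exists (image_submodule A); last by rewrite preimage_image_submodule.
have Smin (P : submodule (quotm N)) q : carrier P q -> q <> 0 -> image_submodule A `<=` P.
  move=> Pq q0 _ [x Ax <-]; rewrite -[q]to_quotm_repr in Pq q0.
  apply: (Amin (preimage_submodule P) (repr q)) => //.
  - exact: sub_preimage_submodule.
  - by move=> /to_quotm_eq0.
apply: (@is_socle_of_simples _ unit (fun=> image_submodule A)) => //.
- move=> _; split; last by move=> P _ q; exact: Smin.
  apply: contrapT => nq; apply: nAN => x Ax; apply: contrapT => nNx; apply: nq.
  by exists (to_quotm N x); [exists x|move=> /to_quotm_eq0].
- by move=> _ q.
- by move=> x Ax; exists [:: tt], (fun=> x); rewrite big_seq1.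
- move=> [|[] [|[] r]] // f _ _; rewrite big_seq1 => f0 [] //.
- by move=> P q Pq /(Smin P q Pq); exists tt.
Qed.

(** [socle_filtration] goes on for all [q]; once [M] is reached the quotient is zero, and its socle
    is the sum of the empty family. *)
Lemma is_socle_quotm_full : N = [set: M] :> set M ->
  exists2 S : submodule (quotm N), is_socle S & [set: M] = to_quotm N @^-1` S.
Proof.
move=> NT; have q0 (q : quotm N) : q = 0.
  by rewrite -[q]to_quotm_repr; apply/to_quotm_eq0; rewrite NT.
exists (zero_submodule _); last by apply/seteqP; split=> // x _; exact: q0.
apply: (@is_socle_of_simples _ void (fun=> zero_submodule _)) => //.
by move=> x _; exists [::], (fun=> 0); split=> //; rewrite big_nil; exact: q0.
Qed.

End Quotients.

Section Subquotients.
Variable M : lieModType g.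

Lemma to_subquot_eq (A N : submodule M) (x y : submod A) :
  to_subquot N x = to_subquot N y <-> carrier N (val x - val y).
Proof. by rewrite -(raddfB (val : submod A -> M)); exact: to_quotm_eq. Qed.

Lemma simple_subquot (A N : submodule M) :
  N `<=` A -> ~ (A `<=` N) ->
  (forall (P : submodule M) x, P `<=` A -> N `<=` P -> carrier P x -> ~ carrier N x -> A `<=` P) ->
  simple_module (subquot A N).
Proof.
move=> NA nAN Amin; split.
  move=> e; apply: nAN => x Ax.
  have : [set: subquot A N] (to_subquot N (insubmod Ax)) by [].
  by rewrite e => /to_quotm_eq0.
move=> Q; pose P := preimage_submodule Q.
have AP := submoduleP A; have PP := submoduleP P.
have [PN|nPN] := pselect (lift_submodule P `<=` N).
  left; apply/seteqP; split=> [q Qq|_ ->]; last exact: (submodule0 (submoduleP _)).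
  rewrite /= -[q]to_quotm_repr; apply/to_quotm_eq0.
  by apply: PN; exists (repr q) => //=; rewrite to_quotm_repr.
have [x Px nNx] : exists2 x, carrier (lift_submodule P) x & ~ carrier N x.
  by apply: contrapT => ny; apply: nPN => y Py; apply: contrapT => y0; apply: ny; exists y.
right; apply/seteqP; split=> // q _.
have := Amin (lift_submodule P) x (@lift_submodule_sub _ _ P) _ Px nNx.
case/(_ _ (val (repr q)) _).
- move=> y Ny; exists (insubmod (NA _ Ny)) => //.
  by apply: sub_preimage_submodule.
- exact/submodule_predP/valP.
- by move=> y Py /val_inj yE; move: Py; rewrite /P /= yE to_quotm_repr.
Qed.

(** The second isomorphism theorem for [A1 = A2 + N1], read from the large pair to the small one.
    The map moves a representative into [A2] by an element of [N1]; [fE] shows that the choice does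
    not matter. *)
Lemma naturally_isomorphic_sub (A1 N1 A2 N2 : submodule M) :
  A2 `<=` A1 -> N2 `<=` N1 -> A2 `&` N1 `<=` N2 ->
  (forall x, carrier A1 x -> exists2 y, carrier A2 y & carrier N1 (x - y)) ->
  naturally_isomorphic A1 N1 A2 N2.
Proof.
move=> A21 N21 AN cov.
have N1P := submoduleP N1; have A2P := submoduleP A2.
have valA (A : submodule M) (y : submod A) : carrier A (val y) by exact/submodule_predP/valP.
have [f0 f0P] : {f0 : submod A1 -> submod A2 & forall x, carrier N1 (val x - val (f0 x))}.
  apply: (@choice _ _ (fun x y => carrier N1 (val x - val y))) => x.
  by have [y Ay Nxy] := cov _ (valA _ x); exists (insubmod Ay).
pose f (q : subquot A1 N1) : subquot A2 N2 := to_subquot N2 (f0 (repr q)).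
have fE x y : carrier N1 (val x - val y) -> f (to_subquot N1 x) = to_subquot N2 y.
  move=> Nxy; apply/to_subquot_eq; apply: AN; split.
    by apply: submoduleB.
  have /to_subquot_eq Nx : to_subquot N1 (repr (to_subquot N1 x)) = to_subquot N1 x.
    exact: to_quotm_repr.
  set x' := repr _ in Nx *.
  have -> : val (f0 x') - val y =
      (val x' - val x) + (val x - val y) - (val x' - val (f0 x')).
    by rewrite subrKA opprB [RHS]addrC subrKA.
  by apply: submoduleB => //; exact: submoduleD.
have fE2 (x : submod A1) : f (to_subquot N1 x) = to_subquot N2 (f0 x) by exact: fE.
exists f; last by move=> x y xy; apply: fE; rewrite xy subrr; exact: submodule0.
split.
- move=> a p q; rewrite -[p in LHS]to_quotm_repr -[q in LHS]to_quotm_repr.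
  rewrite -to_quotm_linear /f /to_subquot -to_quotm_linear; apply: fE.
  have -> (c d : submod A1) (c' d' : submod A2) :
      val (a *: c + d) - val (a *: c' + d') = a *: (val c - val c') + (val d - val d').
    rewrite (linearP (val : submod A1 -> M)) (linearP (val : submod A2 -> M)).
    by rewrite scalerBr opprD addrACA.
  by apply: submoduleD => //; exact: submoduleZ.
- move=> u q; rewrite -[q in LHS]to_quotm_repr.
  rewrite -[lact u (to_quotm _ _)](@to_quotm_act _ _ _ (restr_submodule A1 N1)).
  transitivity (to_subquot N2 (lact u (f0 (repr q)))); last exact: to_quotm_act.
  apply: fE => /=.
  have -> (c d : M) : lact u c - lact u d = lact u (c - d).
    by rewrite addrC -scaleN1r -lact_linearr scaleN1r addrC.
  exact: (submodule_act N1P u (f0P (repr q))).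
- pose h (q : subquot A2 N2) : subquot A1 N1 :=
    to_subquot N1 (insubmod (A21 _ (valA _ (repr q)))).
  exists h => q.
    rewrite -[q]to_quotm_repr fE2; apply/to_subquot_eq => /=.
    have /to_subquot_eq/N21 Nx : to_subquot N2 (repr (to_subquot N2 (f0 (repr q)))) =
       to_subquot N2 (f0 (repr q)) by exact: to_quotm_repr.
    have := submoduleB N1P Nx (f0P (repr q)).
    by rewrite opprB subrKA.
  rewrite -[q in RHS]to_quotm_repr; apply: fE => /=.
  by rewrite subrr; exact: submodule0.
Qed.

(** The isomorphism reads off the coefficient of [e] modulo [N], which is unique because [e] is not
    in [N]. *)
Lemma subquot_trivial (A N : submodule M) (e : M) :
  carrier A e -> ~ carrier N e -> N `<=` A ->
  (forall x, carrier A x -> exists c : K, carrier N (x - c *: e)) ->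
  (forall u x, carrier A x -> carrier N (lact u x)) ->
  lie_isomorphic (subquot A N) (trivial_module g).
Proof.
move=> Ae nNe NA cov Nact.
have NP := submoduleP N.
have valA (y : submod A) : carrier A (val y) by exact/submodule_predP/valP.
have cinj (c d : K) x : carrier N (x - c *: e) -> carrier N (x - d *: e) -> c = d.
  move=> Nc Nd; apply: contrapT => /eqP; rewrite -subr_eq0 => cd; apply: nNe.
  rewrite -[e]scale1r -(mulVf cd) -scalerA; apply: submoduleZ => //.
  have := submoduleB NP Nd Nc; rewrite opprB addrC subrKA.
  by rewrite -scalerBl.
have [f fP] : {f : subquot A N -> trivial_module g &
    forall q, carrier N (val (repr q) - (f q : K) *: e)}.
  by apply: (@choice _ _ (fun q c => carrier N (val (repr q) - (c : K) *: e))) => q; exact: cov.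
have fE x c : carrier N (val x - c *: e) -> f (to_subquot N x) = c.
  move=> Nc; apply: (cinj _ _ _ (fP _)).
  have /to_subquot_eq Nx : to_subquot N (repr (to_subquot N x)) = to_subquot N x.
    exact: to_quotm_repr.
  by have := submoduleD NP Nx Nc; rewrite subrKA.
exists f; split.
- move=> a p q; rewrite -[p in LHS]to_quotm_repr -[q in LHS]to_quotm_repr -to_quotm_linear.
  apply: fE; rewrite linearP /= scalerDl opprD addrACA.
  have -> : (a *: (f p : K^o) : K) = a * f p by [].
  rewrite -scalerA -scalerBr.
  exact: (submoduleD NP (submoduleZ NP a (fP p)) (fP q)).
- move=> u q; rewrite -[q in LHS]to_quotm_repr.
  rewrite -[lact u (to_quotm _ _)](@to_quotm_act _ _ _ (restr_submodule A N)).
  by apply: fE; rewrite scale0r subr0; exact: Nact.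
- exists (fun c : trivial_module g => to_subquot N ((c : K) *: insubmod Ae)) => [q|c].
    rewrite -[q in RHS]to_quotm_repr; apply/to_subquot_eq; rewrite linearZ /=.
    by rewrite -opprB; exact: (submoduleN NP (fP q)).
  by apply: fE; rewrite linearZ /= subrr; exact: submodule0.
Qed.

End Subquotients.

End Submodules.

(** * Row- and column-finite matrices *)

Section Basis.
Variables (K : fieldType) (V : lmodType K) (B : choiceType) (v : B -> V).

Lemma sum_uniq_sub (U : nmodType) (r s : seq B) (F : B -> U) :
  uniq r -> uniq s -> {subset r <= s} -> (forall b, b \notin r -> F b = 0) ->
  \sum_(b <- s) F b = \sum_(b <- r) F b.
Proof.
move=> ru su rs F0.
rewrite (bigID (mem r)) /= [X in _ + X]big1 ?addr0; last by move=> b /F0.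
rewrite -big_filter; apply: perm_big; apply: uniq_perm => // [|b].
  exact: filter_uniq.
by rewrite mem_filter; apply: andb_idr; exact: rs.
Qed.

(** A normal form: [is_basis] allows repeated indices and arbitrary coefficients off the list.
    Without these, two expansions can be moved to a common longer list. *)
Definition expands (x : V) (rc : seq B * (B -> K)) : Prop :=
  [/\ uniq rc.1, forall b, b \notin rc.1 -> rc.2 b = 0 &
      x = \sum_(b <- rc.1) rc.2 b *: v b].

Lemma expands_sub x r c s : expands x (r, c) -> uniq s -> {subset r <= s} ->
  expands x (s, c).
Proof.
move=> [/= ru c0 ->] su rs; split=> //= [b bs|].
  by apply: c0; apply: contra bs; exact: rs.
by apply/esym/sum_uniq_sub => // b /c0 ->; rewrite scale0r.
Qed.

Lemma expands_linear a x y r c s d : expands x (r, c) -> expands y (s, d) ->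
  expands (a *: x + y) (undup (r ++ s), fun b => a * c b + d b).
Proof.
have u : uniq (undup (r ++ s)) by exact: undup_uniq.
have [rs sr] : {subset r <= undup (r ++ s)} /\ {subset s <= undup (r ++ s)}.
  by split=> b bs; rewrite mem_undup mem_cat bs ?orbT.
move=> /expands_sub /(_ u rs) [/= _ c0 ->] /expands_sub /(_ u sr) [/= _ d0 ->].
split=> //= [b bn|]; first by rewrite c0 // d0 // mulr0 addr0.
rewrite scaler_sumr -big_split /=; apply: eq_bigr => b _.
by rewrite scalerA scalerDl.
Qed.

Hypothesis v_basis : is_basis v.

Lemma expands_ex x : exists rc, expands x rc.
Proof.
have [r [c ->]] := v_basis.2 x; elim/big_ind: _ => [|y z [[r1 c1] e1] [[r2 c2] e2]|b _].
- by exists ([::], fun=> 0); split=> //=; rewrite big_nil.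
- by rewrite -[y]scale1r; eexists; exact: expands_linear e1 e2.
- exists ([:: b], fun a => if a == b then c b else 0); split=> //= [a|].
    by rewrite inE => /negPf ->.
  by rewrite big_seq1 eqxx.
Qed.

Definition supp x : seq B := (projT1 (cid (expands_ex x))).1.
Definition coord (b : B) (x : V) : K^o := (projT1 (cid (expands_ex x))).2 b.

Lemma expands_coord x : expands x (supp x, coord^~ x).
Proof. by rewrite /supp /coord; case: cid => -[r c]. Qed.

Lemma coord_unique x r c b : expands x (r, c) -> coord b x = c b.
Proof.
move=> e; have := expands_linear (-1) e (expands_coord x).
rewrite scaleN1r addNr; set s := undup _ => -[/= su c0 xs].
apply/eqP; rewrite -subr_eq0 -mulN1r addrC; apply/eqP.
have [bs|/c0 //] := boolP (b \in s).
exact: (v_basis.1 s _ su (esym xs)).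
Qed.

Lemma coord_linear b : linear (coord b).
Proof.
move=> a x y.
exact: (coord_unique b (expands_linear a (expands_coord x) (expands_coord y))).
Qed.

HB.instance Definition _ b :=
  GRing.isLinear.Build K V K^o _ (coord b) (coord_linear b).

Lemma coord_basis a b : coord a (v b) = (a == b)%:R.
Proof.
rewrite (@coord_unique _ [:: b] (fun a => (a == b)%:R)) //; split=> //= [c|].
  by rewrite inE => /negPf ->.
by rewrite big_seq1 eqxx scale1r.
Qed.

Lemma coord_notin b x : b \notin supp x -> coord b x = 0.
Proof. by case: (expands_coord x) => _ + _; exact. Qed.

Lemma coord_sum x : x = \sum_(b <- supp x) coord b x *: v b.
Proof. by case: (expands_coord x). Qed.

Lemma coord_ext x y : (forall b, coord b x = coord b y) -> x = y.
Proof.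
move=> xy; apply/eqP; rewrite -subr_eq0; apply/eqP.
by rewrite [LHS]coord_sum big1 // => b _; rewrite linearB /= xy subrr scale0r.
Qed.

Lemma finite_coord x : finite_set [set b | coord b x != 0].
Proof.
apply: sub_finite_set (finite_seq (supp x)) => b /=.
by apply: contraNT => /coord_notin ->.
Qed.

Section Extension.
Variable U : lmodType K.

Definition lin (w : B -> U) (x : V) : U := \sum_(b <- supp x) coord b x *: w b.

Lemma linE w x s : uniq s -> {subset supp x <= s} ->
  lin w x = \sum_(b <- s) coord b x *: w b.
Proof.
move=> su xs; apply/esym/sum_uniq_sub => //; first by case: (expands_coord x).
by move=> b /coord_notin ->; rewrite scale0r.
Qed.

Lemma lin_linear w : linear (lin w).
Proof.
move=> a x y; pose s := undup (supp x ++ supp y ++ supp (a *: x + y)).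
have su : uniq s by exact: undup_uniq.
rewrite !(@linE _ _ s) //; try by move=> b; rewrite mem_undup !mem_cat => ->; rewrite ?orbT.
rewrite scaler_sumr -big_split /=; apply: eq_bigr => b _.
by rewrite linearP scalerDl scalerA.
Qed.

Lemma lin_basis w b : lin w (v b) = w b.
Proof.
rewrite (@linE _ _ (undup (b :: supp (v b)))) ?undup_uniq //; last first.
  by move=> c cs; rewrite mem_undup inE cs orbT.
rewrite (bigD1_seq b) ?undup_uniq ?mem_undup ?inE ?eqxx //=.
rewrite coord_basis eqxx scale1r big1 ?addr0 // => c /negPf cb.
by rewrite coord_basis cb scale0r.
Qed.

Lemma lin_ext (f h : V -> U) : linear f -> linear h ->
  (forall b, f (v b) = h (v b)) -> forall x, f x = h x.
Proof.
move=> fL hL fh x.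
have sumL (k : V -> U) : linear k -> k x = \sum_(b <- supp x) coord b x *: k (v b).
  move=> kL; pose k' : {linear V -> U} := HB.pack k (GRing.isLinear.Build _ _ _ _ _ kL).
  rewrite -[k]/(k' : V -> U) {1}[x]coord_sum linear_sum.
  by apply: eq_bigr => b _; rewrite linearZ.
by rewrite (sumL f fL) (sumL h hL); apply: eq_bigr => b _; rewrite fh.
Qed.

End Extension.

Lemma V_starP (x : V -> K^o) :
  V_star v x <-> dualV x /\ finite_set [set b | x (v b) != 0].
Proof.
split=> [Sx|[xL]].
  split; first exact: V_star_dual Sx.
  case: Sx => n [c [u [uS ->]]].
  have /choice [b bP] : forall i, exists b, dual_vector v b (u i).
    by move=> i; have [b _ ub] := uS i; exists b.
  apply: (@sub_finite_set _ _ [set` map b (enum 'I_n)]); last exact: finite_seq.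
  move=> a /=; apply: contraNT => na.
  rewrite fct_sumE big1 // => i _; rewrite scalrfctE (bP i).2.
  have /negPf -> : a != b i; last by rewrite scaler0.
  by apply: contra na => /eqP ->; apply: map_f; rewrite mem_enum.
move=> /finite_seqP [r rE]; pose s := undup r.
have -> : x = \sum_(b <- s) x (v b) *: coord b.
  apply/funext; apply: lin_ext => // [|a].
    move=> a p q; rewrite !fct_sumE scaler_sumr -big_split /=.
    apply: eq_bigr => b _; rewrite !scalrfctE linearP /= scalerDr !scalerA.
    by rewrite mulrC.
  rewrite fct_sumE; under eq_bigr do rewrite scalrfctE coord_basis.
  have [as_|as_] := boolP (a \in s).
    rewrite (bigD1_seq a) ?undup_uniq //= eqxx big1 => [|b /negPf ba].
      by rewrite addr0 /GRing.scale /= mulr1.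
    by rewrite ba scaler0.
  have xa : x (v a) = 0.
    apply/eqP; apply: contraNT as_ => xa; rewrite mem_undup.
    by have : [set` r] a by rewrite -rE.
  rewrite xa big1_seq // => b /= bs; rewrite (_ : b == a = false) ?scaler0 //.
  by apply: contraNF as_ => /eqP <-.
rewrite big_tnth; exists (size s), (fun i => x (v (tnth (in_tuple s) i))).
exists (fun i => coord (tnth (in_tuple s) i)); split=> // i.
exists (tnth (in_tuple s) i) => //; split=> [|a]; first exact: coord_linear.
by rewrite coord_basis eq_sym.
Qed.

Lemma V_star_coord b : V_star v (coord b).
Proof.
apply/V_starP; split; first exact: coord_linear.
apply: sub_finite_set (finite_set1 b) => a /=.
by rewrite coord_basis; have [->//|_] := eqVneq b a; rewrite eqxx.
Qed.

(** Columns are finite automatically, as [w b] lies in [V]. Finite rows are the Mackey condition, by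
    [mackey_rowfin] and [lin_mackey]. *)
Definition rowfin (w : B -> V) := forall a, finite_set [set b | coord a (w b) != 0].

Lemma mackey_linear (f : mackey v) : linear (mackey_val f).
Proof. by have /mackey_predP [] := mackey_valP f. Qed.

Lemma mackey_rowfin (f : mackey v) : rowfin (fun b => f (v b)).
Proof.
move=> a; have /mackey_predP [_ Sf] := mackey_valP f.
by have /V_starP [] := Sf _ (V_star_coord a).
Qed.

Lemma lin_mackey (w : B -> V) : rowfin w -> lin w \in mackey_pred v.
Proof.
move=> wfin; apply/mackey_predP; split; first exact: lin_linear.
move=> x /V_starP [xL xfin]; apply/V_starP; split.
  by move=> a y z /=; rewrite lin_linear xL.
apply: (@sub_finite_set _ _ (\bigcup_(a in [set a | x (v a) != 0])
    [set b | coord a (w b) != 0])); last by apply: bigcup_finite.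
move=> b /=; rewrite lin_basis => xwb; apply: contrapT => nb.
move: xwb; pose x' : {linear V -> K^o} := HB.pack x (GRing.isLinear.Build _ _ _ _ _ xL).
rewrite -[x]/(x' : V -> K^o) {1}[w b]coord_sum linear_sum big1 ?eqxx // => a _.
rewrite linearZ /=; have [->|xa] := eqVneq (x (v a)) 0; first exact: scaler0.
have [->|ca] := eqVneq (coord a (w b)) 0; first exact: scale0r.
by case: nb; exists a.
Qed.

(** The default 0 keeps the constructor total; [rowfin] is discharged only where [mkE] is
    applied. *)
Definition mk (w : B -> V) : mackey v := insubd (0 : mackey v) (lin w).

Lemma mkE w b : rowfin w -> mk w (v b) = w b.
Proof. by move=> /lin_mackey wm; rewrite [mk w : V -> V]insubdK // lin_basis. Qed.

End Basis.

HB.instance Definition _ (K : fieldType) (V : lmodType K) (B : choiceType)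
    (v : B -> V) (f : mackey v) :=
  GRing.isLinear.Build K V V _ (mackey_val f) (mackey_linear f).

Section MackeyRing.
Variables (K : fieldType) (V : lmodType K) (B : choiceType) (v : B -> V).

Lemma mackey_one_closed : (fun u : V => u) \in mackey_pred v.
Proof. by apply/mackey_predP. Qed.

Lemma mackey_mul1 : left_id (Mackey mackey_one_closed) (@mackey_comp _ _ _ v).
Proof. by move=> f; exact: val_inj. Qed.
Lemma mackey_mulr1 : right_id (Mackey mackey_one_closed) (@mackey_comp _ _ _ v).
Proof. by move=> f; exact: val_inj. Qed.
Lemma mackey_mulDl : left_distributive (@mackey_comp _ _ _ v) +%R.
Proof. by move=> f h k; exact: val_inj. Qed.
Lemma mackey_mulDr : right_distributive (@mackey_comp _ _ _ v) +%R.
Proof.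
move=> f h k; have := mackey_compDr f 1 h k; by rewrite !scale1r.
Qed.

HB.instance Definition _ := GRing.Zmodule_isPzRing.Build (mackey v)
  (@mackey_compA _ _ _ v) mackey_mul1 mackey_mulr1 mackey_mulDl mackey_mulDr.

Lemma mackeyM (f h : mackey v) x : (f * h) x = f (h x). Proof. by []. Qed.
Lemma mackey1 x : (1 : mackey v) x = x. Proof. by []. Qed.
Lemma mackeyD (f h : mackey v) x : (f + h) x = f x + h x. Proof. by []. Qed.
Lemma mackeyN (f : mackey v) x : (- f) x = - f x. Proof. by []. Qed.
Lemma mackeyZ a (f : mackey v) x : (a *: f) x = a *: f x. Proof. by []. Qed.
Lemma mackey0 x : (0 : mackey v) x = 0. Proof. by []. Qed.
Lemma liebE (f h : mackey v) : lieb f h = f * h - h * f. Proof. by []. Qed.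

Lemma mackey_sum (J : Type) (r : seq J) (P : pred J) (F : J -> mackey v) x :
  (\sum_(j <- r | P j) F j) x = \sum_(j <- r | P j) F j x.
Proof. by elim/big_rec2: _ => // j y f _ <-. Qed.

Hypothesis v_basis : is_basis v.

Lemma mackey_ext (f h : mackey v) : (forall b, f (v b) = h (v b)) -> f = h.
Proof.
move=> fh; apply: val_inj; apply/funext.
by apply: lin_ext fh => //; exact: mackey_linear.
Qed.

End MackeyRing.

(** * Partial injections, diagonal projections, and closure properties of Lie ideals *)

Section Operators.
Variables (K : fieldType) (V : lmodType K) (B : choiceType) (v : B -> V).
Hypothesis v_basis : is_basis v.
Local Notation coord := (coord v_basis).
Local Notation mk := (mk v_basis).
Implicit Types (f g h : mackey v) (D E S Y : set B) (x : V).

Definition cols f : set B := [set b | f (v b) != 0].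
Definition rows f : set B := [set a | exists b, coord a (f (v b)) != 0].

Lemma colsN f b : ~ cols f b -> f (v b) = 0.
Proof. by move=> /negP/negPn/eqP. Qed.

Lemma rowsN f a b : ~ rows f a -> coord a (f (v b)) = 0.
Proof. by move=> nr; apply/eqP; apply: contrapT => /negP h; apply: nr; exists b. Qed.

Definition op_fun E (s : B -> B) (b : B) : V := if `[< E b >] then v (s b) else 0.
(** The 0-1 matrix of a partial injection. If [s] is not injective on [E], a row may be infinite and
    [mk] then falls back to 0. *)
Definition op E (s : B -> B) : mackey v := mk (op_fun E s).
Definition proj S : mackey v := op S id.

Lemma rowfin_op E s : set_inj E s -> rowfin v_basis (op_fun E s).
Proof.
move=> sI a; apply: (@card_le_finite _ _ _ [set a]) (finite_set1 a).
apply: (@card_le_injOn _ _ _ _ s) => b; rewrite /op_fun /=.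
  case: ifP => _; last by rewrite linear0 eqxx.
  by rewrite coord_basis; case: (a =P s b) => // _; rewrite eqxx.
move=> c /set_mem /=; case: asboolP => Eb; last by rewrite linear0 eqxx.
move=> _ /set_mem /=; case: asboolP => Ec; last by rewrite linear0 eqxx.
by move=> _; apply: sI; rewrite in_setE.
Qed.

Lemma opE E s b : set_inj E s -> op E s (v b) = if `[< E b >] then v (s b) else 0.
Proof. by move=> sI; rewrite mkE //; exact: rowfin_op. Qed.

Lemma op_in E s b : set_inj E s -> E b -> op E s (v b) = v (s b).
Proof. by move=> /opE ->; case: asboolP. Qed.

Lemma op_out E s b : set_inj E s -> ~ E b -> op E s (v b) = 0.
Proof. by move=> /opE ->; case: asboolP. Qed.

Lemma set_inj_id S : set_inj S id. Proof. by []. Qed.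
Local Hint Resolve set_inj_id : core.

Lemma proj_in S b : S b -> proj S (v b) = v b.
Proof. exact: op_in. Qed.

Lemma proj_out S b : ~ S b -> proj S (v b) = 0.
Proof. exact: op_out. Qed.

Lemma coord_op E s b x : set_inj E s -> E b -> coord (s b) (op E s x) = coord b x.
Proof.
move=> sI Eb; move: x; apply: (lin_ext v_basis) => //.
- by move=> a x y; rewrite !linearP.
- by move=> a x y; rewrite linearP.
move=> c; rewrite opE //; case: asboolP => Ec.
  rewrite !coord_basis; have [->|bc] := eqVneq b c; first by rewrite eqxx.
  by case: eqP => // /sI; rewrite !in_setE => /(_ Eb Ec) e; rewrite e eqxx in bc.
rewrite linear0 coord_basis; case: eqP => // e; by rewrite -e in Ec.
Qed.

Lemma coord_op_out E s a x : set_inj E s -> (forall b, E b -> s b <> a) ->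
  coord a (op E s x) = 0.
Proof.
move=> sI na; move: x; apply: (lin_ext v_basis) => //.
- by move=> b x y; rewrite !linearP.
- by move=> b x y; rewrite scaler0 addr0.
move=> c; rewrite opE //; case: asboolP => Ec; last by rewrite linear0.
by rewrite coord_basis; case: eqP => // e; case: (na c Ec).
Qed.

Lemma coord_proj_in S a x : S a -> coord a (proj S x) = coord a x.
Proof. exact: (@coord_op S id). Qed.

Lemma coord_proj_out S a x : ~ S a -> coord a (proj S x) = 0.
Proof. by move=> nSa; apply: coord_op_out => // b Sb ba; rewrite -ba in nSa. Qed.

Lemma rows_op E s : set_inj E s -> rows (op E s) `<=` s @` E.
Proof.
move=> sI a [b]; have [Eb|nEb] := pselect (E b); last by rewrite op_out // linear0 eqxx.
by rewrite op_in // coord_basis; case: (a =P s b) => [-> _|]; [exists b|rewrite eqxx].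
Qed.

Lemma op_proj E s : set_inj E s -> op E s * proj E = op E s.
Proof.
move=> sI; apply: mackey_ext => // b; rewrite mackeyM; have [Eb|nEb] := pselect (E b).
  by rewrite proj_in.
by rewrite proj_out // linear0 op_out.
Qed.

Lemma op_linv E s : set_inj E s -> exists h, h * op E s = proj E.
Proof.
move=> sI.
have [t tP] : {t : B -> B & forall c, (s @` E) c -> E (t c) /\ s (t c) = c}.
  apply: (@choice _ _ (fun c b => (s @` E) c -> E b /\ s b = c)) => c.
  have [[b Eb sb]|nc] := pselect ((s @` E) c); first by exists b.
  by exists c => /nc.
have tI : set_inj (s @` E) t.
  by move=> c d /set_mem /tP [_ sc] /set_mem /tP [_ sd] cd; rewrite -sc -sd cd.
exists (op (s @` E) t); apply: mackey_ext => // b; rewrite mackeyM.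
have [Eb|nEb] := pselect (E b); last by rewrite op_out // linear0 proj_out.
have sEb : (s @` E) (s b) by exists b.
have [Et st] := tP _ sEb.
by rewrite op_in // op_in // proj_in //; congr v; apply: sI; rewrite ?in_setE.
Qed.

Lemma proj_mull S g : rows g `<=` S -> proj S * g = g.
Proof.
move=> gS; apply: mackey_ext => // b; apply: (coord_ext (v_basis := v_basis)) => a.
have [Sa|nSa] := pselect (S a); first by rewrite mackeyM coord_proj_in.
by rewrite mackeyM coord_proj_out // rowsN // => /gS.
Qed.

Lemma proj_mulr S g : cols g `<=` S -> g * proj S = g.
Proof.
move=> gS; apply: mackey_ext => // b; rewrite mackeyM.
have [Sb|nSb] := pselect (S b); first by rewrite proj_in.
by rewrite proj_out // linear0 colsN // => /gS.
Qed.

Lemma proj_proj S : proj S * proj S = proj S.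
Proof. exact: op_proj. Qed.

Lemma proj_disj S S' : S `&` S' = set0 -> proj S * proj S' = 0.
Proof.
move=> SS'; apply: mackey_ext => // b; rewrite mackeyM mackey0.
have [Sb|nSb] := pselect (S' b); last by rewrite proj_out // linear0.
rewrite proj_in // proj_out // => S'b; have : (S `&` S') b by [].
by rewrite SS'.
Qed.

Lemma proj_split S : 1 = proj S + proj (~` S).
Proof.
apply: mackey_ext => // b; rewrite mackeyD mackey1.
have [Sb|nSb] := pselect (S b); first by rewrite proj_in // proj_out ?addr0 //; exact.
by rewrite proj_out // proj_in // add0r.
Qed.

Lemma rows_proj S g : rows (proj S * g) `<=` S `&` rows g.
Proof.
move=> a [b].
rewrite mackeyM; have [Sa|nSa] := pselect (S a); last first.
  by rewrite coord_proj_out // eqxx.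
by rewrite coord_proj_in // => h; split=> //; exists b.
Qed.

Lemma cols_proj S g : cols (g * proj S) `<=` S `&` cols g.
Proof.
move=> b; rewrite /cols /mkset mackeyM; have [Sb|nSb] := pselect (S b).
  by rewrite proj_in.
by rewrite proj_out // linear0 eqxx.
Qed.

Lemma cols_mul f g : cols (f * g) `<=` cols g.
Proof. by move=> b; rewrite /cols /mkset mackeyM; apply: contraNN => /eqP ->; rewrite linear0. Qed.

Lemma rows_mul f g : rows (f * g) `<=` rows f.
Proof.
move=> a [b]; rewrite mackeyM => h; apply: contrapT => na.
move: h; rewrite (_ : coord a (f (g (v b))) = 0) ?eqxx //.
move: (g (v b)); apply: (lin_ext v_basis) => //.
- by move=> c x y; rewrite !linearP.
- by move=> c x y; rewrite scaler0 addr0.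
- by move=> c; rewrite rowsN.
Qed.

Section Ideals.
Hypothesis two_neq0 : (2%:R : K) != 0.
Variable I : set (mackey v).
Hypothesis IP : is_submodule (I : set (adjoint (mackey v))).

Lemma ideal_lieb f g : I g -> I (f * g - g * f).
Proof. exact: (submodule_act IP). Qed.

Lemma ideal_liebC f g : I g -> I (g * f - f * g).
Proof. by move=> /(ideal_lieb f) /(submoduleN IP); rewrite opprB. Qed.

Lemma ideal_mull f g : I g -> g * f = 0 -> I (f * g).
Proof. by move=> /(ideal_lieb f) + gf; rewrite gf subr0. Qed.

Lemma ideal_mulr f g : I g -> f * g = 0 -> I (g * f).
Proof. by move=> /(ideal_liebC f) + gf; rewrite gf subr0. Qed.

(** The double commutator [p, [f, q]] equals p f q + q f p. A further commutator with p turns the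
    plus into a minus, so the two add up to 2 p f q, and 2 is invertible. *)
Lemma ideal_corner p q f : p * p = p -> p * q = 0 -> q * p = 0 -> I f -> I (p * f * q).
Proof.
move=> pp pq qp If.
have Is : I (p * f * q + q * f * p).
  have := ideal_lieb p (ideal_liebC q If).
  rewrite mulrBr mulrBl !mulrA pq mul0r subr0 -[f * q * p]mulrA qp mulr0 sub0r.
  by rewrite opprK.
have := submoduleD IP (ideal_lieb p Is) Is.
rewrite mulrDr mulrDl !mulrA pp pq !mul0r addr0 -[_ * q * p]mulrA qp mulr0 add0r.
rewrite -[_ * p * p]mulrA pp addrACA addNr addr0 -mulr2n.
move=> /(submoduleZ IP (2%:R^-1)).
by rewrite -scaler_nat scalerA mulVf // scale1r.
Qed.

(** The corner [g] of [f] with columns [E] and rows [s(E)] has a single nonzero entry in each column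
    of [E], so it is a weighted partial injection. Multiplying on the right by the diagonal matrix
    of inverse weights is allowed: that matrix lives on [E], which is disjoint from the rows of [g],
    so the opposite product vanishes. *)
Lemma ideal_op E s f : set_inj E s ->
  (forall b c, E b -> E c -> s b <> c) ->
  (forall b, E b -> coord (s b) (f (v b)) != 0) ->
  (forall b c, E b -> E c -> b <> c -> coord (s b) (f (v c)) = 0) ->
  I f -> I (op E s).
Proof.
move=> sI sE f0 fE If.
pose g := proj (s @` E) * f * proj E.
have gE b : E b -> g (v b) = coord (s b) (f (v b)) *: v (s b).
  move=> Eb; rewrite !mackeyM proj_in //; apply: (coord_ext (v_basis := v_basis)) => a.
  rewrite linearZ /= coord_basis; have [[c Ec <-]|na] := pselect ((s @` E) a).
    rewrite coord_proj_in; last by exists c.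
    have [->|/eqP cb] := eqVneq c b; first by rewrite eqxx /GRing.scale /= mulr1.
    rewrite fE // (_ : s c == s b = false) ?scaler0 //.
    by apply/eqP => e; apply: cb; apply: sI; rewrite ?in_setE.
  rewrite coord_proj_out // (_ : a == s b = false) ?scaler0 //.
  by apply/eqP => e; apply: na; exists b.
have g0 b : ~ E b -> g (v b) = 0.
  by move=> nEb; rewrite !mackeyM proj_out // !linear0.
have Ig : I g.
  have d : (s @` E) `&` E = set0.
    by apply/seteqP; split=> // c [[b Eb sbc] Ec]; case: (sE b c).
  by apply: ideal_corner => //; [exact: proj_proj|exact: proj_disj|rewrite proj_disj // setIC].
clearbody g.
pose w b := if `[< E b >] then (coord (s b) (f (v b)))^-1 *: v b else 0.
have wfin : rowfin v_basis w.
  move=> a; apply: sub_finite_set (finite_set1 a) => b /=; rewrite /w.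
  case: asboolP => Eb; last by rewrite linear0 eqxx.
  rewrite linearZ /= coord_basis; case: (a =P b) => [-> //|_]; by rewrite scaler0 eqxx.
have wg : mk w * g = 0.
  apply: mackey_ext => // b; rewrite mackeyM mackey0.
  have [Eb|nEb] := pselect (E b); last by rewrite g0 // linear0.
  rewrite gE // linearZ /= mkE // /w; case: asboolP => [/(sE _ _ Eb)//|_].
  by rewrite scaler0.
suff -> : op E s = g * mk w by exact: ideal_mulr.
apply: mackey_ext => // b; rewrite mackeyM mkE // /w opE //.
case: asboolP => Eb; last by rewrite linear0.
by rewrite linearZ /= gE // scalerA mulVf ?f0 // scale1r.
Qed.

(** The entry of the commutator in row [s b] and column [b] is the difference of the diagonal
    entries of [f] at [s b] and at [b]. *)
Lemma ideal_commutator_op E s f : set_inj E s ->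
  (forall b, E b -> coord (s b) (f (v (s b))) <> coord b (f (v b))) ->
  I f -> exists2 g, I g & forall b, E b -> coord (s b) (g (v b)) != 0.
Proof.
move=> sI fE If; exists (f * op E s - op E s * f); first exact: ideal_liebC.
move=> b Eb; rewrite mackeyD mackeyN !mackeyM linearB /= op_in // coord_op // subr_eq0.
by apply/eqP; exact: fE.
Qed.

Lemma ideal_off_diagonal E s g : set_inj E s -> I (op E s) ->
  cols g #<= E -> rows g `&` E = set0 -> rows g `&` cols g = set0 -> I g.
Proof.
move=> sI Ih gE gE0 gC0.
have [g0|/set0P [b0 _]] := eqVneq (cols g) set0.
  suff -> : g = 0 by exact: submodule0 IP.
  by apply: mackey_ext => // b; rewrite mackey0 colsN // g0.
have [t tE tI] := card_le_ex b0 gE.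
have [h' h'E] := op_linv sI; have [W' W'E] := op_linv tI.
set h := op E s in Ih h'E *; set W := op (cols g) t in W'E *.
have PW : proj E * W = W.
  by apply: proj_mull; apply: subset_trans (rows_op tI) _ => _ [b /tE + <-].
have gX : g = g * W' * h' * h * W.
  rewrite -[g * W' * h' * h]mulrA h'E -[_ * proj E * W]mulrA PW -mulrA W'E.
  by rewrite proj_mulr.
have Pg S' : rows g `&` S' = set0 -> proj S' * g = 0.
  move=> gS; rewrite -(@proj_mull (rows g) g) // mulrA proj_disj ?mul0r //.
  by rewrite setIC.
rewrite gX; apply: ideal_mulr.
  apply: ideal_mull => //.
  by rewrite /h -op_proj // -!mulrA [proj E * _]mulrA Pg // mul0r mulr0.
by rewrite /W -op_proj // -!mulrA [proj _ * _]mulrA Pg // mul0r mulr0.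
Qed.

(** To free the rows of [g] from avoiding [E], halve [E]: the rows of [g] inside [E1] avoid [E2],
    the remaining rows avoid [E1], and either half is large enough. *)
Lemma ideal_disjoint D E s g : infinite_set D -> D #<= E -> set_inj E s ->
  (forall b c, E b -> E c -> s b <> c) -> I (op E s) ->
  cols g #<= D -> rows g `&` cols g = set0 -> I g.
Proof.
move=> Dinf DE sI sE Ih gD gC.
have Einf : infinite_set E by apply: contra_not Dinf; exact: card_le_finite DE.
have [E1 [E2 [E12 E120 EE1 EE2]]] := halves Einf.
have sub S : S `<=` E -> E #<= S -> forall f, cols f `<=` cols g ->
    rows f `<=` rows g -> rows f `&` S = set0 -> I f.
  move=> SE ES f fc fr fS.
  have sIS : set_inj S s.
    by move=> b c /set_mem/SE Eb /set_mem/SE Ec; apply: sI; rewrite in_setE.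
  apply: (@ideal_off_diagonal S s) => //.
  - suff -> : op S s = op E s * proj S.
      apply: ideal_mulr => //; apply: mackey_ext => // b; rewrite mackeyM mackey0.
      have [Eb|nEb] := pselect (E b); last by rewrite op_out // linear0.
      by rewrite op_in // proj_out // => /SE /(sE _ _ Eb).
    apply: mackey_ext => // b; rewrite mackeyM.
    have [Sb|nSb] := pselect (S b); last by rewrite op_out // proj_out // linear0.
    by rewrite proj_in // !op_in //; exact: SE.
  - exact: card_le_trans (subset_card_le fc) (card_le_trans gD (card_le_trans DE ES)).
  - apply/seteqP; split=> // b [/fr gb /fc gb'].
    by have : (rows g `&` cols g) b by []; rewrite gC.
have rowsE S : rows (proj S * g) `<=` rows g by move=> b /rows_proj [].
rewrite -[g]mul1r (proj_split E1) mulrDl; apply: (submoduleD IP).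
  apply: (sub E2 _ EE2 _ (@cols_mul _ _) (rowsE E1)); first by rewrite E12; exact: subsetUr.
  apply/seteqP; split=> // b [/rows_proj [E1b _] E2b].
  by have : (E1 `&` E2) b by []; rewrite E120.
apply: (sub E1 _ EE1 _ (@cols_mul _ _) (rowsE _)); first by rewrite E12; exact: subsetUl.
by apply/seteqP; split=> // b [/rows_proj [nE1b _] E1b].
Qed.

Lemma card_rows D g : infinite_set D -> cols g #<= D -> rows g #<= D.
Proof.
move=> Dinf gD.
have H : \bigcup_(b in cols g) [set a | coord a (g (v b)) != 0] #<= D.
  by apply: card_le_bigcup => // b _; exact: finite_coord.
apply: card_le_trans H; apply: subset_card_le => a [b ab]; exists b => //.
by apply: contraNN ab => /eqP ->; rewrite linear0.
Qed.

(* Eilenberg swindle: copies of g on the levels n of S x nat make g the commutator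
   of X, which moves level n+1 to level n through g, with the shift T. *)
Lemma ideal_swindle D S Y g : infinite_set D ->
  (forall f, cols f #<= D -> rows f `&` cols f = set0 -> I f) ->
  S #<= D -> D #<= Y -> S `&` Y = set0 -> cols g `<=` S -> rows g `<=` S -> I g.
Proof.
move=> Dinf good SD DY SY gcS grS.
have [y0 _] := infinite_setN0 Dinf.
have SND : S `*` [set: nat] #<= D.
  apply: card_le_trans (card_mul_nat Dinf); have [f fD fI] := card_le_ex y0 SD.
  apply: (@card_le_injOn _ _ _ _ (fun p => (f p.1, p.2))) => [[b n] [/= Sb _]|].
    by split=> //; exact: fD.
  move=> [b n] [c m] /set_mem [/= Sb _] /set_mem [/= Sc _] [bc ->].
  by congr (_, _); apply: fI; rewrite ?in_setE.
have [t tY tI] := card_le_ex y0 (card_le_trans SND DY).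
(* Level 0 is [S] itself, so that [g] sits there unchanged; the levels above are placed in [Y] by
   [t]. *)
pose e b n := if n is n'.+1 then t (b, n') else b.
have eI b c n m : S b -> S c -> e b n = e c m -> b = c /\ n = m.
  have nSt a k : S a -> ~ S (t (a, k)).
    move=> Sa Sak; have : (S `&` Y) (t (a, k)) by split=> //; exact: tY.
    by rewrite SY.
  case: n m => [|n] [|m] Sb Sc //= bc; first by case: (nSt c m Sc); rewrite -bc.
    by case: (nSt b n Sb); rewrite bc.
  by have [-> ->] : (b, n) = (c, m) by apply: tI; rewrite ?in_setE.
pose E := [set c | exists b n, S b /\ e b n = c].
have [pl plP] : {pl : B -> B * nat & forall c, E c -> S (pl c).1 /\ e (pl c).1 (pl c).2 = c}.
  apply: (@choice _ _ (fun c p => E c -> S p.1 /\ e p.1 p.2 = c)) => c.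
  by have [[b [n h]]|nc] := pselect (E c); [exists (b, n)|exists (y0, 0%N)].
have Ee b n : S b -> E (e b n) by move=> Sb; exists b, n.
have plE b n : S b -> pl (e b n) = (b, n).
  move=> Sb; have [Sp /eI] := plP _ (Ee _ n Sb).
  by case: (pl _) Sp => c m /= Sc /(_ Sc Sb) [-> ->].
have SE b : S b -> E b by move=> Sb; exact: (Ee b 0%N).
have eIn n : set_inj S (e^~ n).
  by move=> b c /set_mem Sb /set_mem Sc /eI [].
pose L n := op S (e^~ n).
pose w c := if `[< E c >] && (0 < (pl c).2)%N then L (pl c).2.-1 (g (v (pl c).1)) else 0.
have coordL a n x : coord a (L n x) != 0 -> exists2 b, S b & e b n = a.
  move=> h; apply: contrapT => na; move: h.
  by rewrite coord_op_out ?eqxx // => b Sb ba; apply: na; exists b.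
(* Row [e b n] of [X] meets only columns [e c n.+1] with [c] in row [b] of [g], and that row is
   finite. *)
have wfin : rowfin v_basis w.
  move=> a; pose b := (pl a).1; pose n := (pl a).2.
  apply: (@sub_finite_set _ _ ((e^~ n.+1) @` [set c | coord b (g (v c)) != 0])).
    move=> c /=; rewrite /w; case: asboolP => Ec /=; last by rewrite linear0 eqxx.
    case: ltnP => l0; last by rewrite linear0 eqxx.
    move=> h; have [b' Sb' ab'] := coordL _ _ _ h.
    move: h; rewrite -ab' coord_op // => h; exists (pl c).1.
      by rewrite /b -ab' plE.
    rewrite -[LHS]/(e (pl c).1 n.+1).
    have -> : n.+1 = (pl c).2 by rewrite /n -ab' plE //= prednK.
    by case: (plP c Ec).
  exact/finite_image/mackey_rowfin.
pose X := mk w.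
pose sh c := e (pl c).1 (pl c).2.+1.
have shI : set_inj E sh.
  move=> c d /set_mem /plP [Sc ec] /set_mem /plP [Sd ed] /eI [//|//|h [h']].
  by rewrite -ec -ed h h'.
pose T := op E sh.
have XE b n : S b -> X (v (e b n.+1)) = L n (g (v b)).
  by move=> Sb; rewrite mkE // /w plE //=; case: asboolP => // -[]; exact: (Ee b n.+1).
have X0 b : S b -> X (v b) = 0.
  by move=> Sb; rewrite mkE // /w (plE b 0%N) //= andbF.
have Xout c : ~ E c -> X (v c) = 0.
  by move=> nEc; rewrite mkE // /w; case: asboolP.
have TE b n : S b -> T (v (e b n)) = v (e b n.+1).
  by move=> Sb; rewrite op_in // /sh ?plE //; exact: Ee.
have TL n : T * L n = L n.+1.
  apply: mackey_ext => // b; rewrite mackeyM.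
  have [Sb|nSb] := pselect (S b); last by rewrite !op_out // linear0.
  by rewrite [L _ _]op_in // TE // [L _ _]op_in.
have L0 : L 0%N = proj S by [].
have gE : X * T - T * X = g.
  apply: mackey_ext => // c; rewrite mackeyD mackeyN !mackeyM.
  have [[b [n [Sb <-]]]|nEc] := pselect (E c); last first.
    by rewrite op_out // Xout // !linear0 ?oppr0 addr0 colsN // => /gcS /SE.
  rewrite TE // XE //; case: n => [|n].
    have -> : X (v (e b 0%N)) = 0 by exact: X0.
    rewrite (linear0 T).
    by rewrite  subr0 L0 -[LHS]mackeyM proj_mull.
  rewrite XE // -(mackeyM T) TL subrr colsN // => /gcS.
  by move=> /[dup] St /(plE _ 0%N) /=; rewrite -/(e b n.+1) plE // => -[].
rewrite -gE; apply: ideal_liebC.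
(* [X] itself has common rows and columns, but it lowers the level by one. Its columns of one parity
   have rows of the other parity, so each of the two parts falls under [good]. *)
pose Z (i : bool) := [set c | E c /\ odd (pl c).2 = i].
have XZ i : I (X * proj (Z i)).
  have XcZ : cols (X * proj (Z i)) `<=` Z i by move=> c /cols_proj [].
  apply: good.
    apply: card_le_trans (subset_card_le XcZ) (card_le_trans _ SND).
    apply: card_le_trans (card_image_le (fun p => e p.1 p.2) _).
    by apply: subset_card_le => _ [[b [n [Sb <-]]] _]; exists (b, n).
  apply/seteqP; split=> // a [[c] + /XcZ [Ea odda]].
  rewrite mackeyM; have [[[b [n [Sb <-]]]]|nZ] := pselect (Z i c); last first.
    by rewrite proj_out // !linear0 eqxx.
  rewrite plE //= => oddn.
  rewrite proj_in; last by split; [exact: Ee|rewrite plE].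
  case: n oddn => [_|n /= oddn]; first by rewrite X0 // linear0 eqxx.
  rewrite XE // => /coordL [b' Sb' ab']; move: odda; rewrite -ab' plE //= -oddn.
  by case: odd.
suff -> : X = X * proj (Z false) + X * proj (Z true) by exact: (submoduleD IP).
apply: mackey_ext => // c; rewrite mackeyD !mackeyM.
have [Ec|nEc] := pselect (E c); last first.
  by rewrite Xout // !proj_out ?linear0 ?addr0 // => -[].
case: (boolP (odd (pl c).2)) => [o|/negbTE o].
  by rewrite proj_out ?linear0 ?add0r ?proj_in // => -[_]; rewrite o.
by rewrite proj_in // proj_out ?linear0 ?addr0 // => -[_]; rewrite o.
Qed.

(** The swindle needs at least [D] free indices outside the block. Cutting [B] into two parts of
    full size provides them: each diagonal block has the other part free, and the mixed blocks have
    disjoint rows and columns. *)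
Lemma ideal_all D E s g : infinite_set D -> D #<= E -> set_inj E s ->
  (forall b c, E b -> E c -> s b <> c) -> I (op E s) -> cols g #<= D -> I g.
Proof.
move=> Dinf DE sI sE Ih gD.
have good f : cols f #<= D -> rows f `&` cols f = set0 -> I f.
  exact: (@ideal_disjoint D E s).
have DT : D #<= [set: B] by exact: card_leT.
have Binf : infinite_set [set: B] by apply: contra_not Dinf; exact: card_le_finite DT.
have [Y [Y' [YY' Y0 BY BY']]] := halves Binf.
have BYC : [set: B] #<= ~` Y.
  apply: card_le_trans BY' (subset_card_le _) => b Y'b Yb.
  by have : (Y `&` Y') b by []; rewrite Y0.
pose C := cols g `|` rows g.
have CD : C #<= D by apply: card_leU => //; exact: card_rows.
have cblock S S' : cols (proj S * g * proj S') `<=` S' `&` cols g.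
  by move=> b /cols_proj [S'b /cols_mul].
have rblock S S' : rows (proj S * g * proj S') `<=` S `&` rows g.
  by move=> b /rows_mul /rows_proj.
have off S S' : S `&` S' = set0 -> I (proj S * g * proj S').
  move=> SS'; apply: good.
    by apply: card_le_trans gD; apply: subset_card_le => b /cblock [].
  apply/seteqP; split=> // b [/rblock [Sb _] /cblock [S'b _]].
  by have : (S `&` S') b by []; rewrite SS'.
have diag S S' : [set: B] #<= S' -> S `&` S' = set0 -> I (proj S * g * proj S).
  move=> BS' SS'; apply: (@ideal_swindle D (S `&` C) S') => //.
  - by apply: card_le_trans CD; apply: subset_card_le => b [].
  - exact: card_le_trans DT BS'.
  - by apply/seteqP; split=> // b [[Sb _] S'b]; have : (S `&` S') b by []; rewrite SS'.
  - by move=> b /cblock [Sb gb]; split=> //; left.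
  - by move=> b /rblock [Sb gb]; split=> //; right.
have -> : g = (proj Y * g * proj Y + proj Y * g * proj (~` Y))
            + (proj (~` Y) * g * proj Y + proj (~` Y) * g * proj (~` Y)).
  by rewrite -!mulrDr -proj_split !mulr1 -mulrDl -proj_split mul1r.
have YC0 : Y `&` ~` Y = set0 by exact: setICr.
apply: (submoduleD IP); apply: (submoduleD IP).
- exact: diag BYC YC0.
- exact: off.
- by apply: off; rewrite setIC.
- by apply: (diag _ Y) => //; rewrite setIC.
Qed.

End Ideals.
End Operators.

(** * Ideals of the Mackey Lie algebra *)

Section Ideals.
Variables (K : fieldType) (V : lmodType K) (B : choiceType) (v : B -> V).
Hypothesis v_basis : is_basis v.
Local Notation coord := (coord v_basis).
Local Notation op := (op v_basis).
Implicit Types (f g h : mackey v) (D E S : set B) (x : V).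

Hypothesis two_neq0 : (2%:R : K) != 0.
Variable I : set (mackey v).
Hypothesis IP : is_submodule (I : set (adjoint (mackey v))).

Definition offdiag f : set B := [set b | exists a, a <> b /\ coord a (f (v b)) != 0].

(** [F b] joins [b] to the support of column [b]. Disjointness of the [F b] on [E] gives all three
    requirements of [ideal_op] at once: [s] is injective, [s(E)] avoids [E], and row [s b] has no
    entry in another column of [E]. Finite rows put each point in finitely many [F b]. *)
Lemma op_of_offdiag D f : infinite_set D -> D #<= offdiag f -> I f ->
  exists E s, [/\ D #<= E, set_inj E s, forall b c, E b -> E c -> s b <> c & I (op E s)].
Proof.
move=> Dinf Df If.
have [s sP] : {s : B -> B & forall b, offdiag f b ->
    s b <> b /\ coord (s b) (f (v b)) != 0}.
  apply: (@choice _ _ (fun b a => offdiag f b -> a <> b /\ coord a (f (v b)) != 0)) => b.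
  by have [[a h]|nb] := pselect (offdiag f b); [exists a|exists b].
pose F b := b |` [set a | coord a (f (v b)) != 0].
have [||||E [Ef EF fE]] := @sparse_subset _ _ (offdiag f) F.
- by apply: contra_not Dinf; exact: card_le_finite.
- by move=> b _; exists b; left.
- by move=> b _; rewrite finite_setU; split; [exact: finite_set1|exact: finite_coord].
- move=> z; apply: (@sub_finite_set _ _ (z |` [set b | coord z (f (v b)) != 0])).
    by move=> b [_ [->|h]]; [left|right].
  by rewrite finite_setU; split; [exact: finite_set1|exact: mackey_rowfin].
have sF b : E b -> F b (s b) by move=> /Ef /sP [_ h]; right.
have EFz b c z : E b -> E c -> F b z -> F c z -> b = c.
  by move=> Eb Ec Fb Fc; apply: EF => //; exists z.
have sI : set_inj E s.
  move=> b c /set_mem Eb /set_mem Ec sbc; apply: (EFz _ _ (s b)) => //; first exact: sF.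
  by rewrite sbc; exact: sF.
have sE b c : E b -> E c -> s b <> c.
  move=> Eb Ec sbc; have /sP [+ _] := Ef _ Eb; apply.
  by rewrite sbc; apply/esym/(EFz _ _ c) => //; [rewrite -sbc; exact: sF|left].
exists E, s; split=> //; first exact: card_le_trans fE.
apply: (ideal_op two_neq0 IP sI sE _ _ If) => b.
  by move=> /Ef /sP [].
move=> c Eb Ec bc; apply/eqP; apply: contrapT => /negP h; apply: bc.
by apply: (EFz _ _ (s b)) => //; [exact: sF|right].
Qed.

(** If few columns have off-diagonal entries, the diagonal [d] differs from every constant at [D]
    many places. A maximal disjoint family [W] of pairs with different [d]-values is then large, and
    the partial injection along these pairs has a commutator with [f] that is off-diagonal on all of
    them. *)
Lemma offdiag_of_nonscalar D f : infinite_set D ->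
  (forall c, D #<= [set b | f (v b) != c *: v b]) -> I f ->
  exists2 g, I g & D #<= offdiag g.
Proof.
move=> Dinf Df If; have [Dof|nDof] := pselect (D #<= offdiag f); first by exists f.
pose d b := coord b (f (v b)).
have Dd c : D #<= [set b | d b != c].
  have : D #<= offdiag f `|` [set b | d b != c].
    apply: card_le_trans (Df c) (subset_card_le _) => b /= fb.
    have [dc|] := eqVneq (d b) c; last by right.
    left; apply: contrapT => nb; move/negP: fb; apply; apply/eqP.
    apply: (coord_ext (v_basis := v_basis)) => a; rewrite linearZ /= coord_basis.
    have [->|/eqP ab] := eqVneq a b; first by rewrite /GRing.scale /= mulr1.
    by rewrite scaler0; apply/eqP; apply: contrapT => /negP h; apply: nb; exists a.
  by move=> /(card_geU Dinf) [].
pose F (p : B * B) := [set p.1; p.2].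
have [W [Wd WF Wmax]] := max_disjoint F [set p | d p.1 != d p.2].
have WE p q z : W p -> W q -> F p z -> F q z -> p = q.
  by move=> Wp Wq Fp Fq; apply: WF => //; exists z.
(* By maximality [d] is constant off the pairs of [W], and [c] is that value, or 0 if the pairs
   exhaust [B]. *)
have [c cP] : exists c, forall b, d b != c -> (\bigcup_(p in W) F p) b.
  have [UW|/existsNP [b0 nb0]] := pselect (forall b, (\bigcup_(p in W) F p) b).
    by exists 0.
  exists (d b0) => b dbb0; have [|q Wq [z [bz qz]]] := Wmax (b, b0) dbb0.
    by exists b; left.
  case: bz qz => -> qz; first by exists q.
  by case: nb0; exists q.
have W2 : D #<= snd @` W.
  have WW2 : W #<= snd @` W.
    apply: (@card_le_injOn _ _ _ _ snd) => [p Wp|p q /set_mem Wp /set_mem Wq pq].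
      by exists p.
    by apply: (WE _ _ p.2) => //; right; rewrite /= ?pq.
  have : D #<= fst @` W `|` snd @` W.
    apply: card_le_trans (Dd c) (subset_card_le _) => b /cP [p Wp [|] ->].
      by left; exists p.
    by right; exists p.
  move=> /(card_geU Dinf) [D1|//].
  by apply: card_le_trans D1 (card_le_trans _ WW2); exact: card_image_le.
have [s sP] : {s : B -> B & forall b, (snd @` W) b -> W (s b, b)}.
  apply: (@choice _ _ (fun b a => (snd @` W) b -> W (a, b))) => b.
  by have [[[a b'] Wab <-]|nb] := pselect ((snd @` W) b); [exists a|exists b].
have sI : set_inj (snd @` W) s.
  move=> b b' /set_mem /sP Wb /set_mem /sP Wc sbc.
  by have [] := WE _ _ (s b) Wb Wc (or_introl erefl) (or_introl sbc).
have sd b : (snd @` W) b -> d (s b) <> d b.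
  by move=> Eb; apply/eqP; exact: (Wd _ (sP b Eb)).
have [g Ig gP] := ideal_commutator_op IP sI sd If.
exists g => //; apply: card_le_trans W2 (subset_card_le _) => b Eb.
exists (s b); split; last exact: gP.
by move=> sb; have := Wd _ (sP b Eb); rewrite /= sb eqxx.
Qed.

Lemma ideal_full D f g : infinite_set D ->
  (forall c, D #<= [set b | f (v b) != c *: v b]) -> I f -> cols g #<= D -> I g.
Proof.
move=> Dinf Df If; have [h Ih Dh] := offdiag_of_nonscalar Dinf Df If.
have [E [s [DE sI sE Iop]]] := op_of_offdiag Dinf Dh Ih.
exact: (ideal_all IP Dinf DE sI sE Iop).
Qed.

(** The matrix unit in row [a] and column [b]; as a one-point partial injection it falls under the
    lemmas above. *)
Definition elem (a b : B) : mackey v := op [set b] (fun=> a).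

Lemma set_inj1 (b : B) (s : B -> B) : set_inj [set b] s.
Proof. by move=> c d /set_mem -> /set_mem ->. Qed.

Lemma elemE a b c : elem a b (v c) = (c == b)%:R *: v a.
Proof.
rewrite opE; last exact: set_inj1.
by case: asboolP => [->|/eqP/negPf ->]; rewrite ?eqxx ?scale1r ?scale0r.
Qed.

Lemma cols_elem a b : cols (elem a b) `<=` [set b].
Proof.
move=> c; rewrite /cols /mkset elemE; have [->//|_] := eqVneq c b.
by rewrite scale0r eqxx.
Qed.

Lemma rows_elem a b : rows v_basis (elem a b) `<=` [set a].
Proof.
move=> c [d]; rewrite elemE linearZ /= coord_basis.
by have [->//|_] := eqVneq c a; rewrite scaler0 eqxx.
Qed.

Hypothesis B_inf : infinite_set [set: B].

Lemma other (r : seq B) : exists b, b \notin r.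
Proof.
apply: contrapT => nb; apply: B_inf; apply: sub_finite_set (finite_seq r) => b _ /=.
by apply/negPn/negP => br; apply: nb; exists b.
Qed.

Lemma ideal_elem_ex f : I f -> ~ scalars v f -> exists a b, a <> b /\ I (elem a b).
Proof.
move=> If nf.
have off a b h : a <> b -> coord a (h (v b)) != 0 -> I h -> I (elem a b).
  move=> ab hab; apply: (ideal_op (v_basis := v_basis) two_neq0 IP (@set_inj1 _ _)).
  - by move=> c d _ ->.
  - by move=> c ->.
  - by move=> c d -> ->.
have [[a [b [ab fab]]]|nd] :=
    pselect (exists a b, a <> b /\ coord a (f (v b)) != 0).
  by exists a, b; split=> //; exact: off fab If.
have [a [b dab]] : exists a b, coord a (f (v a)) <> coord b (f (v b)).
  apply: contrapT => nab; apply: nf; have [b0 _] := infinite_setN0 B_inf.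
  exists (coord b0 (f (v b0)) : K); apply/funext.
  apply: (lin_ext v_basis) => [|a x y|b]; first exact: mackey_linear.
    by rewrite scalerDr !scalerA mulrC.
  apply: (coord_ext (v_basis := v_basis)) => a; rewrite linearZ /= coord_basis.
  have [->|/eqP ab] := eqVneq a b.
    by rewrite /GRing.scale /= mulr1; apply: contrapT => h; apply: nab; exists b, b0.
  by rewrite scaler0; apply/eqP; apply: contrapT => /negP h; apply: nd; exists a, b.
have ab : a <> b by move=> e; apply: dab; rewrite e.
have sd c : [set b] c -> coord a (f (v a)) <> coord c (f (v c)) by move=> ->.
have [g Ig gP] := ideal_commutator_op IP (@set_inj1 b (fun=> a)) sd If.
by exists a, b; split=> //; exact: (off _ _ _ ab (gP b erefl) Ig).
Qed.

Lemma ideal_elem a b c d : a <> b -> I (elem a b) -> c <> d -> I (elem c d).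
Proof.
have step a' b' c' d' : I (elem a' b') -> c' <> d' -> c' <> b' -> I (elem c' d').
  move=> Iab cd cb.
  apply: (ideal_off_diagonal IP (@set_inj1 b' (fun=> a')) Iab).
  - apply: (@card_le_injOn _ _ _ _ (fun=> b')) => // e1 e2.
    by move=> /set_mem /cols_elem -> /set_mem /cols_elem ->.
  - by apply/seteqP; split=> // e [/rows_elem -> /cb].
  - by apply/seteqP; split=> // e [/rows_elem -> /cols_elem /cd].
(* [step] cannot produce row [b] from a unit in column [b]. In that case the unit is first moved to
   a third column [e]. *)
move=> ab Iab cd; have [cb|/eqP cb] := eqVneq c b; last exact: step Iab cd cb.
have [e] := other [:: a; b]; rewrite !inE => /norP [/eqP ea /eqP eb].
apply: (step a e) => //; last by rewrite cb; exact: nesym.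
by apply: (step a b) => //; exact: nesym.
Qed.

Lemma ideal_elem_diag a b c d : a <> b -> I (elem a b) -> I (elem c c - elem d d).
Proof.
move=> ab Iab; have [->|/eqP cd] := eqVneq c d.
  by rewrite subrr; exact: (submodule0 IP).
suff <- : elem c d * elem d c - elem d c * elem c d = elem c c - elem d d.
  by apply: (ideal_liebC IP); exact: (ideal_elem ab Iab).
have E e1 e2 e3 : elem e1 e2 * elem e2 e3 = elem e1 e3.
  apply: (mackey_ext v_basis) => e; rewrite mackeyM !elemE linearZ /= elemE eqxx.
  by rewrite scale1r.
by rewrite !E.
Qed.

End Ideals.

(** * Elements of finite rank *)

Section FiniteRank.
Variables (K : fieldType) (V : lmodType K) (B : choiceType) (v : B -> V).
Implicit Types (f g h : mackey v) (x : V) (c d : K).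

(* f is the image of a tensor on which the evaluation pairing takes the value c. *)
Definition has_trace f c : Prop :=
  exists (n : nat) (w : 'I_n -> V) (x : 'I_n -> V -> K^o),
    [/\ forall i, V_star v (x i), val f = tensor_endo w x &
        \sum_(i < n) (x i (w i) : K) = c].

Lemma gl_finP f : gl_fin v f <-> exists c, has_trace f c.
Proof.
split=> [[n [w [x [Sx fE]]]]|[c [n [w [x [Sx fE _]]]]]]; last by exists n, w, x.
by exists (\sum_(i < n) (x i (w i) : K)), n, w, x.
Qed.

Lemma sl_finP f : sl_fin v f <-> has_trace f 0.
Proof. by []. Qed.

Lemma has_trace0 : has_trace 0 0.
Proof.
exists 0%N, (fun=> 0), (fun=> 0); split=> [[]//||]; last by rewrite big_ord0.
by apply/funext => u; rewrite /tensor_endo big_ord0.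
Qed.

Lemma has_traceD f g c d : has_trace f c -> has_trace g d -> has_trace (f + g) (c + d).
Proof.
move=> [n [w [x [Sx fE <-]]]] [m [w' [x' [Sx' gE <-]]]].
exists (n + m)%N.
exists (fun i => match fintype.split i with inl j => w j | inr j => w' j end).
exists (fun i => match fintype.split i with inl j => x j | inr j => x' j end).
have El j : fintype.split (lshift m j) = inl j :> ('I_n + 'I_m).
  by rewrite -[lshift m j]/(unsplit (inl j)) unsplitK.
have Er j : fintype.split (rshift n j) = inr j :> ('I_n + 'I_m).
  by rewrite -[rshift n j]/(unsplit (inr j)) unsplitK.
split=> [i||]; first by case: fintype.split.
  apply/funext => u; rewrite /tensor_endo big_split_ord /=.
  transitivity (val f u + val g u); first by [].
  by rewrite fE gE; congr (_ + _); apply: eq_bigr => i _; rewrite ?El ?Er.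
by rewrite big_split_ord; congr (_ + _); apply: eq_bigr => i _; rewrite ?El ?Er.
Qed.

Lemma has_traceZ a f c : has_trace f c -> has_trace (a *: f) (a * c).
Proof.
move=> [n [w [x [Sx fE <-]]]]; exists n, (fun i => a *: w i), x; split=> //.
  apply/funext => u; transitivity (a *: val f u); first by [].
  rewrite fE scaler_sumr; apply: eq_bigr => i _.
  by rewrite !scalerA mulrC.
rewrite mulr_sumr; apply: eq_bigr => i _; have Lx := V_star_dual (Sx i).
by have := Lx a (w i) 0; rewrite !addr0 (linear_at0 Lx) addr0.
Qed.

Lemma has_traceN f c : has_trace f c -> has_trace (- f) (- c).
Proof. by move=> /(has_traceZ (-1)); rewrite scaleN1r mulN1r. Qed.

Lemma has_traceB f g c d : has_trace f c -> has_trace g d -> has_trace (f - g) (c - d).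
Proof. by move=> fc /has_traceN; exact: has_traceD. Qed.

(** The number x_i(h(w_i)) is the pairing of x_i with h(w_i), and also that of x_i composed with h
    with w_i. Sharing [d] is the identity tr(hf) = tr(fh), obtained before uniqueness of the trace
    is known. *)
Lemma has_trace_mul f h c : has_trace f c ->
  exists2 d, has_trace (h * f) d & has_trace (f * h) d.
Proof.
move=> [n [w [x [Sx fE _]]]]; exists (\sum_(i < n) (x i (h (w i)) : K)).
  exists n, (fun i => h (w i)), x; split=> //.
  apply/funext => u; transitivity (h (val f u)); first by [].
  by rewrite fE linear_sum; apply: eq_bigr => i _; rewrite linearZ.
exists n, w, (fun i => x i \o h); split=> //.
  by move=> i; have /mackey_predP [_] := mackey_valP h; apply.
apply/funext => u; transitivity (val f (h u)); first by [].
by rewrite fE.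
Qed.

Lemma has_trace_lieb f h c : has_trace f c -> has_trace (lieb h f) 0.
Proof. by move=> /(has_trace_mul h) [d hf fh]; rewrite -(subrr d); exact: has_traceB. Qed.

Lemma sl_fin_submodule : is_submodule (sl_fin v : set (adjoint (mackey v))).
Proof.
split=> [|a f g /sl_finP f0 /sl_finP g0|h f /sl_finP f0].
- exact: has_trace0.
- by apply/sl_finP; have := has_traceD (has_traceZ a f0) g0; rewrite mulr0 addr0.
- exact: has_trace_lieb f0.
Qed.

Hypothesis v_basis : is_basis v.
Local Notation coord := (coord v_basis).
Local Notation op := (op v_basis).
Local Notation elem := (elem v_basis).

Lemma coord_sum_sub x (r : seq B) : uniq r -> (forall b, b \notin r -> coord b x = 0) ->
  x = \sum_(b <- r) coord b x *: v b.
Proof.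
move=> ru xr; pose s := undup (supp v_basis x ++ r).
have su : uniq s by exact: undup_uniq.
have [xs rs] : {subset supp v_basis x <= s} /\ {subset r <= s}.
  by split=> b bs; rewrite mem_undup mem_cat bs ?orbT.
rewrite [LHS](coord_sum v_basis).
rewrite -(sum_uniq_sub _ su xs); last by move=> b /coord_notin ->; rewrite scale0r.
  by apply: sum_uniq_sub => // b /xr ->; rewrite scale0r.
by case: (expands_coord v_basis x).
Qed.

(** The value [c] is a sum of diagonal entries, so it depends on the matrix alone and not on the
    tensor. The list [r] collects the supports of the w_i, beyond which all rows vanish. *)
Lemma has_trace_sum f c : has_trace f c ->
  exists r : seq B, rows v_basis f `<=` [set` r] /\
    forall s, uniq s -> {subset r <= s} -> \sum_(b <- s) coord b (f (v b)) = c.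
Proof.
move=> [n [w [x [Sx fE <-]]]].
pose r := flatten [seq supp v_basis (w i) | i <- enum 'I_n].
have wr i : {subset supp v_basis (w i) <= r}.
  by move=> b bw; apply/flattenP; exists (supp v_basis (w i)) => //;
    apply: map_f; rewrite mem_enum.
have coordf a b : coord a (f (v b)) = \sum_(i < n) (x i (v b) : K) * coord a (w i).
  rewrite -[mackey_val f]/(val f) fE linear_sum; apply: eq_bigr => i _.
  by rewrite linearZ.
exists r; split=> [a [b]|s su rs].
  rewrite coordf /= => h; apply: contraNT h => ar; rewrite big1 // => i _.
  by rewrite coord_notin ?mulr0 //; apply: contra ar; exact: wr.
under eq_bigr do rewrite coordf.
rewrite exchange_big /=; apply: eq_bigr => i _.
have Lx := V_star_dual (Sx i).
pose x' : {linear V -> K^o} := HB.pack (x i) (GRing.isLinear.Build _ _ _ _ _ Lx).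
rewrite -[x i]/(x' : V -> K^o).
rewrite [in RHS](@coord_sum_sub (w i) s) //; last first.
  by move=> b bs; apply: coord_notin; apply: contra bs => /wr /rs.
by rewrite linear_sum; apply: eq_bigr => b _; rewrite linearZ mulrC.
Qed.

Lemma has_trace_unique f c d : has_trace f c -> has_trace f d -> c = d.
Proof.
move=> /has_trace_sum [r [_ rP]] /has_trace_sum [s [_ sP]].
by rewrite -(rP (undup (r ++ s))) ?undup_uniq ?(sP (undup (r ++ s))) ?undup_uniq //;
  move=> b bs; rewrite mem_undup mem_cat bs ?orbT.
Qed.

Lemma has_trace_elem a b : has_trace (elem a b) (b == a)%:R.
Proof.
exists 1%N, (fun=> v a), (fun=> coord b); split.
- by move=> _; exact: V_star_coord.
- apply/funext; apply: (lin_ext v_basis); first exact: mackey_linear.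
    move=> k x y; rewrite /tensor_endo !big_ord1 linearP scalerDl scalerA.
    by [].
  move=> c; rewrite /tensor_endo big_ord1 coord_basis -[val _]/(mackey_val _).
  by rewrite elemE eq_sym.
- by rewrite big_ord1 coord_basis.
Qed.

(** Each x_i is nonzero at finitely many basis vectors. Conversely, [f] is the sum of the tensors of
    [f (v b)] with [coord b] over its nonzero columns. *)
Lemma gl_fin_cols f : gl_fin v f <-> finite_set (cols f).
Proof.
split=> [[n [w [x [Sx fE]]]]|/finite_seqP [r rE]].
  apply: (@sub_finite_set _ _ (\bigcup_(i in [set: 'I_n]) [set b | x i (v b) != 0])).
    move=> b; rewrite /cols /mkset -[mackey_val f]/(val f) fE => fb.
    apply: contrapT => nb; move/negP: fb; apply; apply/eqP; apply: big1 => i _.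
    have [->|xb] := eqVneq (x i (v b)) 0; first exact: scale0r.
    by case: nb; exists i.
  by apply: bigcup_finite => [|i _]; [exact: finite_finset|have /V_starP [] := Sx i].
pose s := undup r; exists (size s), (fun i => f (v (tnth (in_tuple s) i))).
exists (fun i => coord (tnth (in_tuple s) i)); split=> [i|].
  exact: V_star_coord.
have sE : tensor_endo (fun i => f (v (tnth (in_tuple s) i)))
    (fun i => coord (tnth (in_tuple s) i)) = fun u => \sum_(b <- s) coord b u *: f (v b).
  by apply/funext => u; rewrite [RHS]big_tnth.
rewrite sE; apply/funext; apply: (lin_ext v_basis); first exact: mackey_linear.
  move=> k x y; rewrite scaler_sumr -big_split; apply: eq_bigr => b _ /=.
  by rewrite linearP scalerDl scalerA.
move=> c; have [cs|cs] := boolP (c \in s).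
  rewrite (bigD1_seq c) ?undup_uniq //= coord_basis eqxx scale1r big1 ?addr0 //.
  by move=> b /negPf bc; rewrite coord_basis bc scale0r.
rewrite big1_seq => [|b /= bs]; last first.
  rewrite coord_basis (_ : b == c = false) ?scale0r //.
  by apply: contraNF cs => /eqP <-.
apply: colsN => fc; move: cs; rewrite mem_undup.
by have -> : c \in r by move: fc; rewrite rE.
Qed.

Hypothesis two_neq0 : (2%:R : K) != 0.
Hypothesis B_inf : infinite_set [set: B].
Variable I : set (mackey v).
Hypothesis IP : is_submodule (I : set (adjoint (mackey v))).

Lemma sl_fin_ideal f : I f -> ~ scalars v f -> sl_fin v `<=` I.
Proof.
move=> If nf g /sl_finP gt.
have [a [b [ab Iab]]] := ideal_elem_ex v_basis two_neq0 IP B_inf If nf.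
have [r [rg rP]] := has_trace_sum gt.
have /gl_fin_cols /finite_seqP [r' r'E] : gl_fin v g by apply/gl_finP; exists 0.
pose s := undup (r ++ r').
have su : uniq s by exact: undup_uniq.
have rs : {subset r <= s} by move=> c cr; rewrite mem_undup mem_cat cr.
have [rsub r'sub] : {subset r <= s} /\ {subset r' <= s}.
  by split=> c cr; rewrite mem_undup mem_cat cr ?orbT.
have gE : g = \sum_(d <- s) \sum_(c <- s) (coord c (g (v d)) : K) *: elem c d.
  apply: (mackey_ext v_basis) => e; rewrite mackey_sum.
  have inner (d : B) : (\sum_(c <- s) (coord c (g (v d)) : K) *: elem c d) (v e) =
      (e == d)%:R *: g (v d).
    rewrite mackey_sum [in RHS](@coord_sum_sub (g (v d)) s) //.
      rewrite scaler_sumr; apply: eq_bigr => c _.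
      by rewrite mackeyZ elemE !scalerA mulrC.
    move=> c cs; apply: rowsN => /rg /= cr; move/negP: cs; apply; exact: rsub.
  under eq_bigr do rewrite inner.
  have [es|es] := boolP (e \in s).
    rewrite (bigD1_seq e) //= eqxx scale1r big1 ?addr0 // => d /negPf de.
    by rewrite eq_sym de scale0r.
  rewrite big1_seq => [|d /= ds].
    apply: colsN => ge; move/negP: es; apply; apply: r'sub.
    by have : [set` r'] e by rewrite -r'E.
  rewrite (_ : e == d = false) ?scale0r //.
  by apply: contraNF es => /eqP ->.
(* The corrections on the diagonal add up to the trace of [g] times [elem a a], which is 0. What
   remains are off-diagonal units and differences of diagonal ones. *)
have -> : g = \sum_(d <- s) \sum_(c <- s) (coord c (g (v d)) : K) *:
                (elem c d - (c == d)%:R *: elem a a).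
  under eq_bigr do under eq_bigr do rewrite scalerBr scalerA.
  under eq_bigr do rewrite sumrB.
  rewrite sumrB -gE -[LHS]subr0; congr (_ - _).
  under eq_bigr do rewrite -scaler_suml.
  rewrite -scaler_suml -[LHS](scale0r (elem a a)); congr (_ *: _).
  rewrite -[LHS](rP s su rsub); apply: eq_big_seq => d ds.
  rewrite (bigD1_seq d) //= eqxx mulr1 big1 ?addr0 // => c /negPf cd.
  by rewrite cd mulr0.
apply: (submodule_sum IP) => d _; apply: (submodule_sum IP) => c _.
apply: (submoduleZ IP); have [->|/eqP cd] := eqVneq c d.
  by rewrite scale1r; exact: (ideal_elem_diag IP B_inf d a ab Iab).
by rewrite scale0r subr0; exact: (ideal_elem IP B_inf ab Iab).
Qed.

End FiniteRank.

(** * The ideals gl^M_s through their nonzero columns *)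

Section Layers.
Variables (K : fieldType) (V : lmodType K) (B : choiceType) (v : B -> V).
Hypothesis v_basis : is_basis v.
Local Notation coord := (coord v_basis).
Local Notation proj := (proj v_basis).
Implicit Types (f g h : mackey v) (D E S : set B) (x : V).

Lemma cols_linear (a : K) f g : cols (a *: f + g) `<=` cols f `|` cols g.
Proof.
move=> b; rewrite /cols /mkset mackeyD mackeyZ => h.
have [f0|] := eqVneq (f (v b)) 0; last by left.
by right; move: h; rewrite f0 scaler0 add0r.
Qed.

(** A nonzero column of [f * h] has an entry of [h] in some row from [cols f]. The rows of [h] are
    finite, so [f * h] has no more nonzero columns than [f], up to finite numbers. *)
Lemma cols_lieb (U : Type) (D : set U) h f :
  infinite_set D -> D #<= cols (lieb h f) -> D #<= cols f.
Proof.
move=> Dinf; rewrite liebE -scaleN1r addrC => Dhf.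
have := card_le_trans Dhf (subset_card_le (@cols_linear _ _ _)).
move=> /(card_geU Dinf) [|Df]; last exact: card_le_trans (subset_card_le (@cols_mul _ _ _ _ h f)).
have sub : cols (f * h) `<=` \bigcup_(a in cols f) [set b | coord a (h (v b)) != 0].
  move=> b fb; apply: contrapT => nb; move: fb; rewrite /cols /mkset mackeyM.
  rewrite (coord_sum v_basis (h (v b))) linear_sum big1 ?eqxx // => a _.
  rewrite linearZ /=; have [->|fa] := eqVneq (f (v a)) 0; first exact: scaler0.
  have [->|ha] := eqVneq (coord a (h (v b))) 0; first exact: scale0r.
  by case: nb; exists a.
move=> Dfh; have Dsub := card_le_trans Dfh (subset_card_le sub).
have [ffin|finf] := pselect (finite_set (cols f)).
  case: Dinf; apply: card_le_finite Dsub _; apply: bigcup_finite => // a _.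
  exact: mackey_rowfin.
apply: card_le_trans Dsub _; apply: card_le_bigcup => // a _.
exact: mackey_rowfin.
Qed.

Lemma mackey_ltP s (U : Type) (D : set U) f : has_aleph s D ->
  mackey_lt v s f <-> ~ (D #<= cols f).
Proof.
move=> aD; split=> [flt Df|nDf x xL]; last first.
  split; first by move=> a y z /=; rewrite linearP xL.
  apply/(card_lt_alephP _ aD); apply: contra_not nDf => Dxf.
  apply: card_le_trans Dxf (subset_card_le _) => b /=; apply: contraNN => /eqP ->.
  by rewrite (linear_at0 xL).
pose F b := [set a | coord a (f (v b)) != 0].
have [||||E [Ef EF fE]] := @sparse_subset _ _ (cols f) F.
- by apply: contra_not (has_aleph_infinite aD); exact: card_le_finite.
- move=> b fb; apply: contrapT => nb; move/negP: fb; apply; apply/eqP.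
  apply: (coord_ext (v_basis := v_basis)) => a; rewrite linear0; apply/eqP.
  by apply: contrapT => /negP h; apply: nb; exists a.
- by move=> b _; exact: finite_coord.
- move=> z; apply: sub_finite_set (mackey_rowfin v_basis f z) => b [] //.
have [s' sP] : {s' : B -> B & forall b, E b -> F b (s' b)}.
  apply: (@choice _ _ (fun b a => E b -> F b a)) => b.
  have [Eb|nEb] := pselect (E b); last by exists b.
  apply: contrapT => nb; move/negP: (Ef _ Eb); apply; apply/eqP.
  apply: (coord_ext (v_basis := v_basis)) => a; rewrite linear0; apply/eqP.
  by apply: contrapT => /negP h; apply: nb; exists a.
(* The sum of the coordinates at the chosen points [s' b]. As the column supports are disjoint on
   [E], its value on [f (v b)] is the single entry in row [s' b], without cancellation. *)
pose x := lin v_basis (fun a => (`[< (s' @` E) a >]%:R : K^o)).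
have xL : dualV x by exact: lin_linear.
have [_ /(card_lt_alephP _ aD)] := flt x xL; apply.
apply: card_le_trans Df (card_le_trans fE (subset_card_le _)) => b Eb /=.
rewrite /x /lin; rewrite (bigD1_seq (s' b)) /=; first last.
- by case: (expands_coord v_basis (f (v b))).
- by apply/negPn/negP => /coord_notin e; have := sP b Eb; rewrite /F /= e eqxx.
rewrite big1 ?addr0 => [|a asb].
  case: asboolP => [_|[]]; last by exists b.
  by rewrite /GRing.scale /= mulr1; exact: sP.
case: asboolP => [[c Ec sca]|_]; last exact: scaler0.
have [->|ca] := eqVneq (coord a (f (v b))) 0; first exact: scale0r.
suff cb : c = b by rewrite -sca cb eqxx in asb.
by apply: EF => //; exists a; split=> //; rewrite -sca; exact: sP.
Qed.

Lemma mackey_lt_submodule s (U : Type) (D : set U) : has_aleph s D ->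
  is_submodule (mackey_lt v s : set (adjoint (mackey v))).
Proof.
move=> aD; have Dinf := has_aleph_infinite aD.
split=> [|a f g /(mackey_ltP _ aD) fD /(mackey_ltP _ aD) gD|h f /(mackey_ltP _ aD) fD];
  apply/(mackey_ltP _ aD).
- have -> : cols (0 : mackey v) = set0 by apply/seteqP; split=> // b; rewrite /cols /= eqxx.
  by move=> /card_le0P D0; apply: Dinf; rewrite D0.
- move=> Dfg; have := card_le_trans Dfg (subset_card_le (@cols_linear a f g)).
  by move=> /(card_geU Dinf) [].
- by apply: contra_not fD; exact: cols_lieb.
Qed.

Lemma mackey_lt0 : mackey_lt v 0 = gl_fin v.
Proof.
have aN : has_aleph 0 [set: nat] by exact: card_eqxx.
apply/seteqP; split=> f.
  move=> /(mackey_ltP _ aN) nf; apply/(gl_fin_cols v_basis); apply: contrapT.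
  by move=> /infiniteP.
move=> /(gl_fin_cols v_basis) ffin; apply/(mackey_ltP _ aN) => nf.
by move/infiniteP: nf; exact.
Qed.

Lemma scalars_submodule : is_submodule (scalars v : set (adjoint (mackey v))).
Proof.
split=> [|k f g [a fE] [b gE]|h f [a fE]].
- by exists 0; apply/funext => u; rewrite scale0r.
- exists (k * a + b); apply/funext => u.
  transitivity (k *: val f u + val g u); first by [].
  by rewrite fE gE scalerDl scalerA.
- exists 0; apply/funext => u; rewrite scale0r.
  transitivity (h (val f u) - val f (h u)); first by [].
  by rewrite fE linearZ subrr.
Qed.

Definition scal (a : K) : mackey v := a *: (1 : mackey v).

Lemma scalarsP f : scalars v f <-> exists a, f = scal a.
Proof.
split=> [[a fE]|[a ->]]; last by exists a.
by exists a; apply: val_inj; rewrite fE.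
Qed.

Lemma scal_basis a b : scal a (v b) = a *: v b. Proof. by []. Qed.

Lemma basis_neq0 b : v b != 0.
Proof.
apply/eqP => vb; have := coord_basis v_basis b b; rewrite vb linear0 eqxx.
by move/eqP; rewrite eq_sym oner_eq0.
Qed.

Lemma cols_scal a : a != 0 -> cols (scal a) = [set: B].
Proof.
move=> a0; apply/seteqP; split=> // b _.
by rewrite /cols /mkset scal_basis scaler_eq0 negb_or a0 basis_neq0.
Qed.

Lemma scalars_mackey_lt s (D : set B) : has_aleph s D ->
  scalars v `&` mackey_lt v s = [set 0].
Proof.
move=> aD; apply/seteqP; split=> [f [/scalarsP [a ->] /(mackey_ltP _ aD) nD]|_ ->].
  have [->|a0] := eqVneq a 0; first by rewrite /scal scale0r.
  by case: nD; rewrite cols_scal //; exact: card_leT.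
by split; [exact: (submodule0 scalars_submodule)|exact: (submodule0 (mackey_lt_submodule aD))].
Qed.

(* Half of the diagonal of size D: neither it nor its complement is small. *)
Lemma proj_not_scalar s (D : set B) : has_aleph s D ->
  exists2 f, cols f #<= D & ~ sum_set (scalars v : set (adjoint (mackey v))) (mackey_lt v s) f.
Proof.
move=> aD; have Dinf := has_aleph_infinite aD.
have [D1 [D2 [D12 D120 DD1 DD2]]] := halves Dinf.
exists (proj D1).
  apply: (card_le_trans (subset_card_le _) (card_lexx D)) => b.
  rewrite D12 /cols /mkset => h; left; apply: contrapT => nD1.
  by move: h; rewrite proj_out // eqxx.
move=> [_ /scalarsP [a ->] [g /(mackey_ltP _ aD) nDg fE]]; apply: nDg.
have gE b : g (v b) = proj D1 (v b) - a *: v b.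
  by rewrite -scal_basis -mackeyN -mackeyD fE addrC addKr.
have [a0|a0] := eqVneq a 0.
  apply: card_le_trans DD1 (subset_card_le _) => b D1b.
  by rewrite /cols /mkset gE proj_in // a0 scale0r subr0 basis_neq0.
apply: card_le_trans DD2 (subset_card_le _) => b D2b.
rewrite /cols /mkset gE proj_out => [|D1b].
  by rewrite sub0r oppr_eq0 scaler_eq0 negb_or a0 basis_neq0.
by have : (D1 `&` D2) b by []; rewrite D120.
Qed.

Hypothesis two_neq0 : (2%:R : K) != 0.
Variable I : set (mackey v).
Hypothesis IP : is_submodule (I : set (adjoint (mackey v))).

(** To lie outside C id + gl^M_s means that f - c id has at least aleph_s nonzero columns for every
    c, which is the input of [ideal_full]. *)
Lemma large_ideal s (D : set B) f g : has_aleph s D -> I f ->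
  ~ sum_set (scalars v : set (adjoint (mackey v))) (mackey_lt v s) f ->
  cols g #<= D -> I g.
Proof.
move=> aD If nf; apply: (ideal_full v_basis two_neq0 IP (has_aleph_infinite aD) _ If).
move=> c; apply: contrapT => nD; apply: nf.
exists (scal c); first by apply/scalarsP; exists c.
exists (f - scal c); last by rewrite addrC subrK.
apply/(mackey_ltP _ aD); apply: contra_not nD => Dfc.
apply: card_le_trans Dfc (subset_card_le _) => b.
rewrite /cols /mkset mackeyD mackeyN scal_basis.
by apply: contraNN => /eqP ->; rewrite subrr.
Qed.

End Layers.

(** * The socle filtration *)

Section Chain.
Variables (K : fieldType) (V : lmodType K) (B : choiceType) (v : B -> V).
Hypothesis two_neq0 : (2%:R : K) != 0.
Hypothesis v_basis : is_basis v.
Variable t : nat.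
Hypothesis B_card : has_aleph t [set: B].
Local Notation elem := (elem v_basis).
Local Notation M := (adjoint (mackey v)).
Implicit Types (f g : M) (P : submodule M).

Let B_inf : infinite_set [set: B] := has_aleph_infinite B_card.

Lemma ex_aleph s : (s <= t)%N -> exists D : set B, has_aleph s D.
Proof. by move=> st; have [D _ aD] := has_aleph_sub st B_card; exists D. Qed.

(** Index s+3 carries gl^M_s for s up to t, so t+4 is the first index with the whole module, and it
    is the length. The constant tail serves filtrations indexed by all of nat. *)
Definition chain_set (i : nat) : set M :=
  match i with
  | 0 => [set 0]
  | 1 => scalars v
  | 2 => sum_set (scalars v : set M) (sl_fin v)
  | s.+3 => if (s <= t)%N then sum_set (scalars v : set M) (mackey_lt v s) else [set: M]
  end.

Lemma chain_submodule i : is_submodule (chain_set i).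
Proof.
have scalP : is_submodule (scalars v : set M) := scalars_submodule v.
case: i => [|[|[|s]]] /=.
- exact: is_submodule_zero.
- exact: scalP.
- apply: sum_set_submodule scalP (sl_fin_submodule v).
- case: leqP => [st|_]; last exact: is_submodule_full.
  have [D aD] := ex_aleph st.
  exact: sum_set_submodule scalP (mackey_lt_submodule v_basis aD).
Qed.

Definition chain i : submodule M := Submodule (chain_submodule i).

Lemma scal_neq0 (a : K) : a != 0 -> scal v a <> 0.
Proof.
move=> a0 e; have [b _] := infinite_setN0 B_inf.
have : b \in cols (scal v a) by rewrite in_setE cols_scal.
by rewrite e in_setE /cols /= eqxx.
Qed.

Let scalP : is_submodule (scalars v : set M) := scalars_submodule v.
Let slP : is_submodule (sl_fin v : set M) := sl_fin_submodule v.

Lemma scalars_sub P f : carrier P f -> f <> 0 -> scalars v f -> scalars v `<=` P.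
Proof.
move=> Pf f0 /scalarsP [a fE] _ /scalarsP [b ->].
have a0 : a != 0 by apply/eqP => a0; apply: f0; rewrite fE a0 /scal scale0r.
have -> : scal v b = (b / a) *: f by rewrite fE /scal scalerA divfK.
exact: (submoduleZ (submoduleP P) _ Pf).
Qed.

Lemma sl_sub P f : carrier P f -> ~ scalars v f -> sl_fin v `<=` P.
Proof. exact: (sl_fin_ideal v_basis two_neq0 B_inf (submoduleP P)). Qed.

Lemma gl_fin_mackey_lt s : (s <= t)%N -> gl_fin v `<=` mackey_lt v s.
Proof.
move=> st; have [D aD] := ex_aleph st => f /(gl_fin_cols v_basis) ffin.
apply/(mackey_ltP v_basis _ aD) => Df.
exact: has_aleph_infinite aD (card_le_finite Df ffin).
Qed.

Lemma scalars_gl0 : scalars v `&` gl_fin v = [set 0].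
Proof.
by have [D aD] := ex_aleph (leq0n t); rewrite -(mackey_lt0 v_basis) (scalars_mackey_lt v_basis aD).
Qed.

Lemma sl_gl : sl_fin v `<=` gl_fin v.
Proof. by move=> f /sl_finP f0; apply/gl_finP; exists 0. Qed.

Lemma scalars_sl0 : scalars v `&` sl_fin v = [set 0].
Proof.
apply/seteqP; split=> [f [fa /sl_gl fg]|_ ->].
  by rewrite -scalars_gl0.
by split; [exact: (submodule0 scalP)|exact: (submodule0 slP)].
Qed.

Lemma sl_neq0 : exists2 f, sl_fin v f & f <> 0.
Proof.
have [b _] := infinite_setN0 B_inf; have [a] := other B_inf [:: b].
rewrite inE => ab; exists (elem a b).
  by apply/sl_finP; have := has_trace_elem v_basis a b; rewrite eq_sym (negPf ab).
move=> e; have := elemE v_basis a b b.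
by rewrite e eqxx scale1r mackey0 => /esym/eqP; rewrite (negPf (basis_neq0 v_basis a)).
Qed.

(** The unit has trace 1. Removing an element of sl would leave a scalar of finite rank with trace
    1, but the only scalar of finite rank is 0. *)
Lemma elem_not_sl b : ~ sum_set (scalars v : set M) (sl_fin v) (elem b b).
Proof.
move=> [f fa [g /sl_finP g0 e]].
have e1 : has_trace (elem b b) 1 by have := has_trace_elem v_basis b b; rewrite eqxx.
have f1 : has_trace f 1.
  have -> : f = elem b b - g by rewrite e addrK.
  by have := has_traceB e1 g0; rewrite subr0.
have f0 : f = 0.
  by have : (scalars v `&` gl_fin v) f; [split=> //; apply/gl_finP; exists 1|rewrite scalars_gl0].
have := has_trace_unique v_basis f1; rewrite f0 => /(_ _ (has_trace0 v)) /eqP.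
by rewrite oner_eq0.
Qed.

Lemma mackey_lt_incr s : (s < t)%N -> mackey_lt v s `<=` mackey_lt v s.+1.
Proof.
move=> st g gs; have [E aE] := ex_aleph st; have [D [DE aD _ _]] := aE.
apply/(mackey_ltP v_basis _ aE); move/(mackey_ltP v_basis _ aD): gs.
by apply: contra_not; exact: card_le_trans (subset_card_le DE).
Qed.

Lemma chain_sub i : chain i `<=` chain i.+1.
Proof.
case: i => [|[|[|s]]] /=.
- by move=> _ ->; exact: (submodule0 scalP).
- exact: sum_setl slP.
- move=> _ [f fa [g /sl_gl gg ->]]; exists f => //; exists g => //.
  exact: gl_fin_mackey_lt.
- have [st|//] := ltnP s t; rewrite (ltnW st) => _ [f fa [g gs ->]].
  by exists f => //; exists g => //; exact: mackey_lt_incr.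
Qed.

Lemma chain_large s P f g (D : set B) : (s <= t)%N -> has_aleph s D ->
  carrier P f -> ~ chain_set s.+3 f -> cols g #<= D -> carrier P g.
Proof.
move=> st aD Pf nf; apply: (large_ideal v_basis two_neq0 (submoduleP P) aD Pf).
by move: nf; rewrite /= st.
Qed.

Lemma chain_full P f : carrier P f -> ~ chain_set t.+3 f -> P = [set: M] :> set M.
Proof.
move=> Pf nf; apply/seteqP; split=> // g _.
exact: (chain_large (leqnn t) B_card Pf nf (card_leT _)).
Qed.

(** Each case uses a generation result: [sl_sub] for a nonscalar element, a trace argument next, and
    [chain_large] above. This is what makes the submodules containing C id a chain. *)
Lemma chain_min i P f : chain 1 `<=` P -> carrier P f -> ~ chain_set i f -> chain i.+1 `<=` P.
Proof.
have PP := submoduleP P; move=> scP Pf.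
case: i => [|[|[|s]]] //= nf.
  by apply: (sum_set_sub PP scP); exact: sl_sub Pf nf.
  rewrite (mackey_lt0 v_basis); apply: (sum_set_sub PP scP) => g gg.
  (* If [f] is a scalar plus a finite rank [k], then [k] has trace [c] different from 0, and
     subtracting (d/c) k from a [g] of trace [d] lands in sl. Otherwise [f] is large enough to
     generate all finite rank elements. *)
  have [[h ha [k kg fE]]|nf'] := pselect (sum_set (scalars v : set M) (gl_fin v) f); last first.
    have [D aD] := ex_aleph (leq0n t).
    apply: (chain_large (leq0n t) aD Pf); first by rewrite /= (mackey_lt0 v_basis).
    have /infiniteP ND := has_aleph_infinite aD.
    have /(mackey_ltP v_basis _ (card_eqxx _ : has_aleph 0 [set: nat])) nN : mackey_lt v 0 g.
      by rewrite (mackey_lt0 v_basis).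
    have [//|gD] := card_le_total (cols g) D.
    by case: nN; exact: card_le_trans gD.
  have /gl_finP [c kc] := kg; have /gl_finP [d gd] := gg.
  have c0 : c != 0.
    by apply/eqP => c0; apply: nf; exists h => //; exists k => //; apply/sl_finP; rewrite -c0.
  have slPP : sl_fin v `<=` P.
    apply: (sl_sub Pf) => fa; apply: nf; exact: (sum_setl slP fa).
  have -> : g = (g - (d / c) *: k) + (d / c) *: (f - h).
    have -> : f - h = k by rewrite fE addrC addKr.
    by rewrite subrK.
  apply: (submoduleD PP).
    apply: slPP; apply/sl_finP; have := has_traceB gd (has_traceZ (d / c) kc).
    by rewrite divfK // subrr.
  by apply: (submoduleZ PP); apply: (submoduleB PP) => //; exact: scP.
(* For s = t the next term is the whole module; for s > t already [chain_set s.+3] is everything,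
   against [nf]. *)
case: ltnP => st; last first.
  have {}st : (s = t) \/ (t < s)%N by move: st; rewrite leq_eqVlt => /predU1P[->|]; [left|right].
  case: st nf => [->|st] nf; last by case: nf; rewrite leqNgt st.
  by rewrite (chain_full Pf).
apply: (sum_set_sub PP scP) => g.
have [D aD] := ex_aleph (ltnW st); have [E aE] := ex_aleph st.
move=> /(mackey_ltP v_basis _ aE) nEg; apply: (chain_large (ltnW st) aD Pf) => //.
by apply/(card_lt_alephSP _ aE aD)/(card_lt_alephP _ aE).
Qed.

(** Witnesses: the identity, a nonzero element of sl, a diagonal unit of trace 1, and then the
    projection onto half of a set of size aleph_s. *)
Lemma chain_proper i : (i < t + 4)%N -> ~ (chain i.+1 `<=` chain i).
Proof.
have [b _] := infinite_setN0 B_inf.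
case: i => [|[|[|s]]] /= it sub.
- have : scalars v (scal v 1) by apply/scalarsP; exists 1.
  by move=> /sub; apply: scal_neq0; exact: oner_neq0.
- have [f fs f0] := sl_neq0; apply: f0.
  have fa : scalars v f by apply: sub; exact: sum_setr fs.
  by have : (scalars v `&` sl_fin v) f by []; rewrite scalars_sl0.
- have : sum_set (scalars v : set M) (mackey_lt v 0) (elem b b).
    apply: sum_setr => //; rewrite (mackey_lt0 v_basis); apply/gl_finP.
    by exists 1; have := has_trace_elem v_basis b b; rewrite eqxx.
  by move=> /sub; exact: elem_not_sl.
- have st : (s <= t)%N by move: it; rewrite addnC !ltnS.
  have [D aD] := ex_aleph st; rewrite st in sub.
  have [f fD nf] := proj_not_scalar v_basis aD; apply: nf; apply: sub.
  case: ltnP => // st'; have [E aE] := ex_aleph st'.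
  apply: sum_setr => //; apply/(mackey_ltP v_basis _ aE)/(card_lt_alephP _ aE).
  exact/(card_lt_alephSP _ aE aD).
Qed.

Lemma chain_scalars i : (0 < i)%N -> chain 1 `<=` chain i.
Proof.
case: i => // i _; elim: i => [//|i IHi].
exact: subset_trans IHi (@chain_sub _).
Qed.

Lemma chain_subquot_simple i : (i < t + 4)%N ->
  simple_module (subquot (chain i.+1) (chain i)).
Proof.
move=> it; apply: simple_subquot; [exact: chain_sub|exact: chain_proper|].
move=> P f PC CP Pf nf; apply: (chain_min _ Pf nf).
(* For i = 0 the inclusion of C id in [P] is not given, but a nonzero submodule of the line C id is
   the whole line. *)
case: i it PC CP nf => [|i] it PC CP nf; last first.
  by apply: subset_trans CP; exact: chain_scalars.
by apply: (scalars_sub Pf) => //; exact: (PC f Pf).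
Qed.

(** The term C id is skipped, because C id and sl enter the socle together; from then on socle
    indices are one less than chain indices. *)
Definition soc_chain q : submodule M := if q is q'.+1 then chain q'.+2 else chain 0.

Lemma soc_chainE q : (0 < q)%N -> soc_chain q = chain q.+1. Proof. by case: q. Qed.

Lemma nonzero_contains P f : carrier P f -> f <> 0 ->
  scalars v `<=` P \/ sl_fin v `<=` P.
Proof.
move=> Pf f0; have [fa|nfa] := pselect (scalars v f).
  by left; exact: scalars_sub fa.
by right; exact: sl_sub nfa.
Qed.

(** C id and sl are simple, meet in 0, and every nonzero submodule contains one of them, according
    to whether it has a nonzero scalar or a nonscalar element. *)
Lemma soc1 : is_socle (soc_chain 1).
Proof.
have ssub0 f : scalars v f -> sl_fin v f -> f = 0.
  by move=> fa fs; have : (scalars v `&` sl_fin v) f by []; rewrite scalars_sl0.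
pose S (i : bool) : submodule M := if i then Submodule scalP else Submodule slP.
have Ssc f i : carrier (S i) f -> carrier (S (~~ i)) f -> f = 0.
  by case: i => /= h h'; exact: ssub0.
apply: (@is_socle_of_simples _ _ _ _ S).
- case=> /=; split.
  + by exists (scal v 1); [apply/scalarsP; exists 1|apply: scal_neq0; exact: oner_neq0].
  + by move=> P PS f Pf f0; exact: (scalars_sub Pf f0 (PS f Pf)).
  + exact: sl_neq0.
  + move=> P PS f Pf f0; apply: (sl_sub Pf) => fa; apply: f0.
    exact: ssub0 fa (PS f Pf).
- case; [exact: sum_setl slP|exact: sum_setr scalP].
- move=> _ [f fa [g gs ->]]; exists [:: true; false], (fun i => if i then f else g).
  by split=> [[]|] //; rewrite big_cons big_seq1.
- move=> r f ru Sf; have Sf2 : f true + f false = 0 -> f true = 0 /\ f false = 0.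
    move=> e; have ft : f true = - f false by apply/eqP; rewrite -addr_eq0 e.
    have f0 : f true = 0.
      by apply: (Ssc _ true); [exact: Sf|rewrite ft; apply: (submoduleN slP); exact: (Sf false)].
    by split=> //; apply/eqP; rewrite -oppr_eq0 -ft f0.
  (* A repetition-free list over [bool] has at most two entries. *)
  case: r ru => [|i [|j [|k r]]] ru; rewrite ?(big_cons, big_nil) ?addr0 //.
  + by move=> fi j; rewrite inE => /eqP ->.
  + by case: i j ru => [] [] // _; last rewrite addrC; move=> /Sf2 [ft ff] [].
  + by move: ru; rewrite /= !inE; case: i j k => [] [] [] //=; rewrite ?andbF.
- move=> P f Pf /(nonzero_contains Pf) [h|h]; [by exists true|by exists false].
Qed.

Lemma soc_filtration : socle_filtration soc_chain.
Proof.
split=> [//||q]; first exact: soc1.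
rewrite !soc_chainE //; have [qt|tq] := ltnP q.+2 (t + 4).
  apply: is_socle_quotm; [exact: chain_sub|exact: chain_proper|].
  move=> P f CP Pf nf; apply: chain_min Pf nf; apply: subset_trans CP.
  exact: chain_scalars.
have full i : (t + 4 <= i)%N -> chain i = [set: M] :> set M.
  rewrite addnC; case: i => [|[|[|s]]] //=; rewrite !ltnS => ts.
  by rewrite leqNgt ts.
rewrite (full q.+3) ?(leqW tq) //; exact/is_socle_quotm_full/full.
Qed.

(** Two summands not contained in C id would both contain sl. If a nonzero summand lies in C id, the
    other must leave C id + gl^M_t for the sum to be everything, and is then everything itself by
    [chain_full]. *)
Lemma adjoint_indecomposable : indecomposable M.
Proof.
split=> [e|A1 A2 [A1P A2P TA A120]].
  have : [set: M] (scal v 1) by [].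
  by rewrite e; apply: scal_neq0; exact: oner_neq0.
have nz (P : submodule M) : P <> [set 0] :> set M -> exists2 f, carrier P f & f <> 0.
  move=> P0; apply: contrapT => nf; apply: P0; apply/seteqP; split=> [f Pf|_ ->].
    by apply: contrapT => f0; apply: nf; exists f.
  exact: (submodule0 (submoduleP P)).
have full (A C : submodule M) f : carrier A f -> f <> 0 -> A `<=` scalars v ->
    [set: M] = sum_set A C -> C = [set: M] :> set M.
  move=> Af f0 Asc TAC; have [g Cg ng] : exists2 g, carrier C g & ~ chain_set t.+3 g.
    apply: contrapT => nC; apply: (@chain_proper t.+2.+1); first by rewrite addnC.
    have -> : chain t.+4 = sum_set A C :> set M.
      by rewrite -TAC /= ltnn.
    apply: sum_set_sub (chain_submodule _) _ _.
      by apply: subset_trans Asc _; exact: chain_scalars.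
    by move=> g Cg; apply: contrapT => ng; apply: nC; exists g.
  exact: chain_full Cg ng.
have [|/nz [f Af f0]] := pselect (A1 = [set 0] :> set M); first by left.
have [|/nz [g Ag g0]] := pselect (A2 = [set 0] :> set M); first by right.
have [Asc|nAsc] := pselect (A1 `<=` scalars v).
  have A2T := full A1 A2 f Af f0 Asc TA.
  by left; rewrite -A120 A2T setIT.
have [Asc|nAsc'] := pselect (A2 `<=` scalars v).
  have A1T : A1 = [set: M] :> set M.
    apply: full Ag g0 Asc _; rewrite TA; apply/seteqP.
    by split=> _ [a Aa [c Cc ->]]; exists c => //; exists a => //; rewrite addrC.
  by right; rewrite -A120 A1T setTI.
have sub (P : submodule M) : ~ (P `<=` scalars v) -> sl_fin v `<=` P.
  move=> nP; have [h Ph nh] : exists2 h, carrier P h & ~ scalars v h.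
    apply: contrapT => nex; apply: nP => h Ph; apply: contrapT => nh.
    by apply: nex; exists h.
  exact: sl_sub Ph nh.
have [h hs h0] := sl_neq0.
have : (A1 `&` A2) h by split; exact: sub.
by rewrite A120.
Qed.

Lemma adjoint_length : has_length M (t + 4).
Proof.
exists chain; split=> [//||i it].
  by rewrite addnC /= ltnn.
by split; [exact: chain_sub|exact: chain_subquot_simple].
Qed.

Lemma internal_dsum_sum_set (A C : set M) : is_submodule A -> is_submodule C ->
  A `&` C = [set 0] -> internal_dsum (sum_set A C) A C.
Proof. by []. Qed.

Lemma chain_dsum s : (s <= t)%N ->
  internal_dsum (chain s.+3) (scalars v) (mackey_lt v s).
Proof.
move=> st; have [D aD] := ex_aleph st; rewrite /= st.
apply: internal_dsum_sum_set => //; first exact: (mackey_lt_submodule v_basis aD).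
exact: (scalars_mackey_lt v_basis aD).
Qed.

(** A diagonal unit spans the quotient, the coordinate being the trace. The action kills scalars and
    sends finite rank elements to trace 0. *)
Lemma layer2_trivial : lie_isomorphic (layer soc_chain 2) (trivial_module (mackey v)).
Proof.
have [b _] := infinite_setN0 B_inf.
have C3 : carrier (chain 3) = sum_set (scalars v : set M) (gl_fin v) by rewrite /= mackey_lt0.
have ebb : has_trace (elem b b) 1 by have := has_trace_elem v_basis b b; rewrite eqxx.
apply: (@subquot_trivial _ _ _ _ _ (elem b b : M)).
- by rewrite [X in X _]C3; apply: sum_setr => //; apply/gl_finP; exists 1.
- exact: elem_not_sl.
- exact: chain_sub.
- move=> f; rewrite [X in X _ -> _]C3 => -[h ha [g /gl_finP [c gc] ->]]; exists c.
  exists h => //; exists (g - c *: elem b b); last by rewrite addrA.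
  by apply/sl_finP; have := has_traceB gc (has_traceZ c ebb); rewrite mulr1 subrr.
- move=> u f; rewrite [X in X _ -> _]C3 => -[h [a hE] [g /gl_finP [c gc] ->]].
  have -> : lact u (h + g) = lieb u g.
    have := lact_linearr (s := M) u 1 h g; rewrite !scale1r => ->.
    suff -> : lact u h = 0 by rewrite add0r.
    apply: val_inj; apply/funext => x; transitivity (u (val h x) - val h (u x)); first by [].
    by rewrite hE linearZ subrr.
  by apply: sum_setr => //; exact: has_trace_lieb gc.
Qed.

(** The summand C id cancels: it lies in both terms of the chain and meets gl^M_(s+1) only in 0. *)
Lemma layer_natural s (A N : submodule M) : (s < t)%N ->
  A = mackey_lt v s.+1 :> set M -> N = mackey_lt v s :> set M ->
  naturally_isomorphic (chain s.+4) (chain s.+3) A N.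
Proof.
move=> st AE NE; have := chain_dsum st; have := chain_dsum (ltnW st).
move=> [_ lP C3 _] [_ ltP C4 AC].
apply: naturally_isomorphic_sub.
- by rewrite AE C4; exact: sum_setr scalP.
- by rewrite NE C3; exact: sum_setr scalP.
- rewrite AE NE C3 => f [fA [h ha [g gs fE]]].
  have gA : mackey_lt v s.+1 g by exact: mackey_lt_incr.
  suff h0 : h = 0 by rewrite fE h0 add0r.
  have : (scalars v `&` mackey_lt v s.+1) h.
    by split=> //; have := submoduleB ltP fA gA; rewrite fE addrK.
  by rewrite AC.
- move=> f; rewrite C4 => -[h ha [g gs fE]]; exists g; first by rewrite AE.
  by rewrite C3 fE addrK; exact: (sum_setl lP ha).
Qed.

Lemma adjoint_socle_filtration :
  internal_dsum (soc_chain 1) (scalars v) (sl_fin v) /\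
  internal_dsum (soc_chain 2) (scalars v) (gl_fin v).
Proof.
split; first exact: (internal_dsum_sum_set scalP slP scalars_sl0).
by rewrite -(mackey_lt0 v_basis); exact: chain_dsum.
Qed.

End Chain.

Theorem theorem2p6 (R : realType) (t : nat) (V : lmodType R[i])
    (B : choiceType) (v : B -> V)
    (v_basis : is_basis v) (B_card : has_aleph t [set: B]) :
  let M : lieModType (mackey v) := adjoint (mackey v) in
  indecomposable M /\
  has_length M (t + 4)%N /\
  exists F : nat -> submodule M,
    socle_filtration F /\
    internal_dsum (F 1%N) (scalars v) (sl_fin v) /\
    (internal_dsum (F 2%N) (scalars v) (gl_fin v) /\
     lie_isomorphic (layer F 2%N) (trivial_module (mackey v))) /\
    (forall s : nat, (s < t)%N ->
       internal_dsum (F (s + 3)%N) (scalars v) (mackey_lt v s.+1) /\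
       exists A N : submodule M,
         [/\ A = mackey_lt v s.+1 :> set M, N = mackey_lt v s :> set M &
             naturally_isomorphic (F (s + 3)%N) (F (s + 2)%N) A N]) /\
    (F (t + 3)%N = [set: M] :> set M /\
     exists N : submodule M,
       internal_dsum N (scalars v) (mackey_lt v t) /\
       naturally_isomorphic (F (t + 3)%N) (F (t + 2)%N) (full_submodule M) N) /\
    (forall s : nat, (1 <= s)%N -> (s + 1 <= t + 3)%N ->
       simple_module (layer F (s + 1)%N)).
Proof.
move=> M.
have two_neq0 : (2%:R : R[i]) != 0 by rewrite pnatr_eq0.
split; first exact: (adjoint_indecomposable two_neq0 v_basis B_card).
split; first exact: (adjoint_length two_neq0 v_basis B_card).
have chainT : chain v_basis B_card t.+4 = [set: M] :> set M by rewrite /= ltnn.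
exists (soc_chain v_basis B_card).
have [soc1 soc2] := adjoint_socle_filtration v_basis B_card.
split; first exact: (soc_filtration two_neq0 v_basis B_card).
split; first exact: soc1.
split; first by split; [exact: soc2|exact: layer2_trivial].
split.
  move=> s st; rewrite addn3 addn2; split; first exact: chain_dsum.
  have [_ AP _ _] := chain_dsum v_basis B_card st.
  have [_ NP _ _] := chain_dsum v_basis B_card (ltnW st).
  by exists (Submodule AP), (Submodule NP); split=> //; exact: layer_natural.
split.
  split; first by rewrite addn3; exact: chainT.
  (* This [N] is the preceding term of the filtration itself, so the isomorphism only identifies the
     top term with the full module. *)
  exists (chain v_basis B_card t.+3); split; first exact: chain_dsum.
  rewrite addn3 addn2; apply: naturally_isomorphic_sub => //.
  - by rewrite [X in _ `<=` X]chainT.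
  - by move=> f _; exists f => //; rewrite subrr; exact: (submodule0 (submoduleP _)).
move=> [//|s] _; rewrite addn1 addn3 !ltnS => st.
by apply: (chain_subquot_simple two_neq0 v_basis B_card); rewrite addnC !ltnS.
Qed.
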